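(* For each nonnegative integer $k$, the map $\pi\mapsto\mathrm{DL}_k(\mathrm{swl}(\pi))$ is well defined on $\mathcal U_{2k+1}(132)$ and is a bijection $\mathrm{DL}_k\circ\mathrm{swl}:\mathcal U_{2k+1}(132)\to\mathrm{Int}(\mathcal L_k^T)$.
   Context: Permutations are finite words of distinct positive integers; $S_n$ is the set of permutations of $[n]$. The stack-sorting map $s$: $s(\text{empty})=\text{empty}$, and if $\pi=LnR$ with $n$ the largest entry, $s(\pi)=s(L)s(R)n$. $\pi$ is uniquely sorted if it has exactly one preimage under $s$. A permutation avoids $\tau$ if no subsequence has the same relative order as $\tau$; $\mathcal U_n(\tau)$ is the set of uniquely sorted permutations in $S_n$ avoiding $\tau$. A descent of $\pi$ is an index $i$ with $\pi_i>\pi_{i+1}$; $\mathrm{Des}(\pi)$ is the set of descents. $\mathrm{rev}$ reverses a word, $\pi^{-1}$ is the group inverse, $\mathrm{rot}(\pi)=\mathrm{rev}(\pi^{-1})$, and $\mathrm{rot}^{-1}$ is its inverse. Sliding operators: for $\pi\in S_n$, $i\in[n]$, let $L_i$ (resp. $R_i$) be the set of elements of $[i-1]$ to the left (resp. right) of the entry $i$ in $\pi$. $\mathrm{swu}_i(\pi)$ has $j$-th entry $\pi_j$ if $\pi_j\ge i$, $m$ if $\pi_j$ is the $m$-th smallest element of $R_i$, and $i-m$ if $\pi_j$ is the $m$-th largest element of $L_i$. $\mathrm{swl}_i=\mathrm{rot}^{-1}\circ\mathrm{swu}_i\circ\mathrm{rot}$ and $\mathrm{swl}=\mathrm{swl}_1\circ\cdots\circ\mathrm{swl}_n$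 on $S_n$. Dyck paths: $\mathbf D_k$ is the set of words in $\{U,D\}$ with $k$ of each letter whose every prefix has at least as many $U$'s as $D$'s. Writing $\Lambda=UD^{\gamma_1}\cdots UD^{\gamma_k}$, $\mathrm{lon}_j(\Lambda)$ is the least $t\ge0$ with $\gamma_j+\cdots+\gamma_{j+t}>t$. The Tamari lattice $\mathcal L_k^T$ is $\mathbf D_k$ with $\Lambda\le_T\Lambda'$ iff $\mathrm{lon}_j(\Lambda)\le\mathrm{lon}_j(\Lambda')$ for all $j\in[k]$. $\mathrm{Int}(P)$ is the set of pairs $(x,y)$ with $x\le y$ in $P$. For $\pi\in\mathcal U_{2k+1}(312)$, $n=2k+1$, let $\Lambda_i=D$ if $n-i\in\mathrm{Des}(\pi)$ and $U$ otherwise, $\Lambda'_i=U$ if $i\in\mathrm{Des}(\mathrm{rot}(\pi))$ and $D$ otherwise ($1\le i\le 2k$), and $\mathrm{DL}_k(\pi)=(\Lambda_1\cdots\Lambda_{2k},\Lambda'_1\cdots\Lambda'_{2k})$. *)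

(* Defs.v *)
From HB Require Import structures.
From mathcomp Require Import all_boot.
From mathcomp Require Import classical_sets functions.

Set Implicit Arguments.
Unset Strict Implicit.
Unset Printing Implicit Defensive.

Local Open Scope classical_set_scope.

(* Words are [seq nat] in one-line notation.  Positions and descents are
   numbered from 1: the i-th entry of p is [nth 0 p i.-1]. *)

Definition perm_word (p : seq nat) : bool := uniq p && (0 \notin p).

Definition Sn (n : nat) : set (seq nat) := [set p | perm_eq p (iota 1 n)].

(* The fuel m only serves termination; see [stack_sort_cat]. *)
Fixpoint stack_sort_rec (m : nat) (p : seq nat) : seq nat :=
  if m is m'.+1 then
    if p is [::] then [::] else
      let n := \max_(x <- p) x in
      let i := index n p in
      stack_sort_rec m' (take i p) ++ stack_sort_rec m' (drop i.+1 p) ++ [:: n]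
  else [::].

Definition stack_sort (p : seq nat) : seq nat := stack_sort_rec (size p) p.

Definition uniquely_sorted (p : seq nat) : Prop :=
  exists! q : seq nat, perm_word q /\ stack_sort q = p.

Definition same_relative_order (u v : seq nat) : Prop :=
  size u = size v /\
  forall i j, i < size u -> j < size u ->
    (nth 0 u i < nth 0 u j) = (nth 0 v i < nth 0 v j).

Definition avoids (p tau : seq nat) : Prop :=
  ~ exists2 u, subseq u p & same_relative_order u tau.

Definition US (n : nat) (tau : seq nat) : set (seq nat) :=
  [set p | [/\ Sn n p, uniquely_sorted p & avoids p tau]].

Definition Des (p : seq nat) : {pred nat} :=
  [pred i | (0 < i < size p) && (nth 0 p i < nth 0 p i.-1)].

Definition perm_inv (p : seq nat) : seq nat :=
  [seq (index v p).+1 | v <- iota 1 (size p)].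

Definition rot_perm (p : seq nat) : seq nat := rev (perm_inv p).

(* Two-sided inverse of [rot_perm] on each [Sn n]; see [rot_permK] and
   [rot_perm_invK]. *)
Definition rot_perm_inv (p : seq nat) : seq nat := perm_inv (rev p).

Definition Lset (i : nat) (p : seq nat) : seq nat :=
  [seq x <- take (index i p) p | x < i].

Definition Rset (i : nat) (p : seq nat) : seq nat :=
  [seq x <- drop (index i p).+1 p | x < i].

(* [count (fun y => y <= x) (Rset i p)] is the m such that x is the m-th
   smallest element of R_i; dually for L_i. *)
Definition swu (i : nat) (p : seq nat) : seq nat :=
  [seq if i <= x then x
       else if x \in Rset i p then count (fun y => y <= x) (Rset i p)
       else i - count (fun y => x <= y) (Lset i p)
  | x <- p].

Definition swl_at (i : nat) (p : seq nat) : seq nat :=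
  rot_perm_inv (swu i (rot_perm p)).

(* swl_1 o ... o swl_n: swl_n is applied first. *)
Definition swl (p : seq nat) : seq nat := foldr swl_at p (iota 1 (size p)).

Inductive step := U | D.

Definition bool_of_step (a : step) : bool := if a is U then true else false.
Definition step_of_bool (b : bool) : step := if b then U else D.
Lemma bool_of_stepK : cancel bool_of_step step_of_bool. Proof. by case. Qed.
HB.instance Definition _ := Equality.copy step (can_type bool_of_stepK).

Definition Dyck (k : nat) : set (seq step) :=
  [set w | [/\ count_mem U w = k, count_mem D w = k &
    forall i, count_mem D (take i w) <= count_mem U (take i w)]].

(* The sequence of exponents gamma_1, ..., gamma_k of
   w = U D^gamma_1 ... U D^gamma_k; see [gammasK]. *)
Fixpoint gammas (w : seq step) : seq nat :=
  match w with
  | [::] => [::]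
  | U :: w' => index U w' :: gammas w'
  | D :: w' => gammas w'
  end.

(* The least t among 0, ..., k - 1; on Dyck paths one exists, see [lonP]. *)
Definition lon (w : seq step) (j : nat) : nat :=
  find (fun t => t < \sum_(j <= i < (j + t).+1) nth 0 (gammas w) i.-1)
       (iota 0 (size (gammas w))).

Definition tamari_le (k : nat) (w w' : seq step) : Prop :=
  forall j, 1 <= j <= k -> lon w j <= lon w' j.

Definition Int (T : Type) (P : set T) (le : T -> T -> Prop) : set (T * T) :=
  [set xy | [/\ P xy.1, P xy.2 & le xy.1 xy.2]].

Definition DL (k : nat) (p : seq nat) : seq step * seq step :=
  let n := k.*2.+1 in
  ([seq if n - i \in Des p then D else U | i <- iota 1 k.*2],
   [seq if i \in Des (rot_perm p) then U else D | i <- iota 1 k.*2]).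

Lemma max_word_mem (p : seq nat) : p != [::] -> \max_(x <- p) x \in p.
Proof.
elim: p => // x p IH _; rewrite big_cons inE /=.
have [h|h] := leqP (\max_(y <- p) y) x.
  by rewrite eqxx.
rewrite IH ?orbT //.
by apply: contraTneq h => ->; rewrite big_nil.
Qed.

Lemma stack_sort_rec_fuel m p :
  size p <= m -> stack_sort_rec m p = stack_sort p.
Proof.
suff H m1 m2 q : size q <= m1 -> size q <= m2 ->
  stack_sort_rec m1 q = stack_sort_rec m2 q by move=> Hm; exact: H.
elim: m1 m2 q => [|m1 IH] [|m2] [|x q] // H1 H2.
have Hq : index (\max_(y <- x :: q) y) (x :: q) < (size q).+1.
  by rewrite -[(size q).+1]/(size (x :: q)) index_mem max_word_mem.
rewrite [LHS]/= [RHS]/=; set i := index _ _ in Hq *; rewrite -/i.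
have Ht : size (take i (x :: q)) <= size q by rewrite size_take Hq.
have Hd : size (drop i q) <= size q by rewrite size_drop leq_subr.
congr (_ ++ (_ ++ _)); apply: IH; [exact: leq_trans Ht H1|exact: leq_trans Ht H2|
  exact: leq_trans Hd H1|exact: leq_trans Hd H2].
Qed.

Lemma stack_sort_cat (l r : seq nat) (n : nat) :
  (forall x, x \in l -> x < n) -> (forall x, x \in r -> x < n) ->
  stack_sort (l ++ n :: r) = stack_sort l ++ stack_sort r ++ [:: n].
Proof.
move=> Hl Hr; set p := l ++ n :: r.
have Emax : \max_(x <- p) x = n.
  apply/eqP; rewrite eqn_leq; apply/andP; split.
    apply/bigmax_leqP_seq => x; rewrite mem_cat inE => /or3P[/Hl/ltnW||/Hr/ltnW] //.
    by move/eqP->.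
  have Hn : n \in p by rewrite mem_cat mem_head orbT.
  exact: (@leq_bigmax_seq _ p xpredT id n Hn isT).
have Ei : index n p = size l.
  rewrite index_cat /= eqxx addn0; case: ifP => // /Hl; by rewrite ltnn.
have Ep : p != [::] by rewrite /p; case: (l).
rewrite {1}/stack_sort.
have -> : size p = (size l + size r).+1 by rewrite size_cat /= addnS.
have -> : stack_sort_rec (size l + size r).+1 p =
  stack_sort_rec (size l + size r) (take (size l) p) ++
  stack_sort_rec (size l + size r) (drop (size l).+1 p) ++ [:: n].
  by move: Ep Emax Ei; case: (p) => // x q _ /= -> ->.
have -> : drop (size l).+1 p = r.
  by rewrite -add1n -drop_drop drop_size_cat //= drop0.
by rewrite take_size_cat // !stack_sort_rec_fuel ?leq_addr ?leq_addl.
Qed.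

Lemma Sn_size n p : Sn n p -> size p = n.
Proof. by move/perm_size; rewrite size_iota. Qed.

Lemma Sn_uniq n p : Sn n p -> uniq p.
Proof. by move/perm_uniq ->; rewrite iota_uniq. Qed.

Lemma Sn_mem n p : Sn n p -> forall v, (v \in p) = (0 < v <= n).
Proof. by move=> /perm_mem E v; rewrite E mem_iota add1n ltnS. Qed.

Lemma perm_inv_Sn n p : Sn n p -> Sn n (perm_inv p).
Proof.
move=> Hp; have Hs := Sn_size Hp.
have Hi : {in iota 1 n &, injective (fun v => (index v p).+1)}.
  move=> v w; rewrite !mem_iota add1n !ltnS -!(Sn_mem Hp) => Hv Hw [].
  by move/(congr1 (nth 0 p)); rewrite !nth_index.
have Hu : uniq (perm_inv p) by rewrite /perm_inv Hs map_inj_in_uniq ?iota_uniq.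
apply: uniq_perm => //; first exact: iota_uniq.
have Hsub : {subset perm_inv p <= iota 1 n}.
  move=> x /mapP[v]; rewrite Hs mem_iota add1n ltnS -(Sn_mem Hp) => Hv ->.
  by rewrite mem_iota add1n !ltnS /= -Hs index_mem.
have [|//] := uniq_min_size Hu Hsub.
by rewrite /perm_inv size_map !size_iota Hs.
Qed.

Lemma perm_invK n p : Sn n p -> perm_inv (perm_inv p) = p.
Proof.
move=> Hp; have Hs := Sn_size Hp; have Hq := perm_inv_Sn Hp.
have Hqs := Sn_size Hq.
apply: (@eq_from_nth _ 0) => [|i]; first by rewrite size_map size_iota Hqs Hs.
rewrite size_map size_iota => Hi.
rewrite (nth_map 0) ?size_iota // nth_iota // add1n.
have Hin : i < size p by rewrite Hs -Hqs.
have Hv : nth 0 p i \in p by rewrite mem_nth.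
move: (Hv); rewrite (Sn_mem Hp) => /andP[H0 H1].
have Hlt : (nth 0 p i).-1 < n by rewrite prednK.
have E : nth 0 (perm_inv p) (nth 0 p i).-1 = i.+1.
  rewrite (nth_map 0) ?size_iota ?Hs // nth_iota // add1n prednK //.
  by rewrite index_uniq ?(Sn_uniq Hp).
by rewrite -E index_uniq ?Hqs ?(Sn_uniq Hq) // prednK.
Qed.

Lemma rev_Sn n p : Sn n p -> Sn n (rev p).
Proof. by rewrite /Sn /= perm_rev. Qed.

Lemma rot_perm_Sn n p : Sn n p -> Sn n (rot_perm p).
Proof. by move/perm_inv_Sn/rev_Sn. Qed.

Lemma rot_perm_inv_Sn n p : Sn n p -> Sn n (rot_perm_inv p).
Proof. by move/rev_Sn/perm_inv_Sn. Qed.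

Lemma rot_permK n p : Sn n p -> rot_perm_inv (rot_perm p) = p.
Proof. by move=> Hp; rewrite /rot_perm_inv revK (perm_invK Hp). Qed.

Lemma rot_perm_invK n p : Sn n p -> rot_perm (rot_perm_inv p) = p.
Proof. by move=> Hp; rewrite /rot_perm (perm_invK (rev_Sn Hp)) revK. Qed.

Lemma gammasK (w : seq step) :
  w = nseq (index U w) D ++ flatten [seq U :: nseq g D | g <- gammas w].
Proof. by elim: w => [//|[] w IH] /=; rewrite {1}IH. Qed.

Lemma size_gammas w : size (gammas w) = count_mem U w.
Proof. by elim: w => [//|[] w IH] /=; rewrite IH. Qed.

Lemma Dyck_index k w : Dyck k w -> index U w = 0.
Proof. by case: w => [//|[] w] [_ _ /(_ 1)] /=; rewrite ?take0. Qed.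

Lemma count_blocks (g : seq nat) :
  let w := flatten [seq U :: nseq x D | x <- g] in
  count_mem U w = size g /\ count_mem D w = sumn g.
Proof.
elim: g => [//|x g [IH1 IH2]] /=.
by rewrite !count_cat !count_nseq /= IH1 IH2 !mul0n mul1n.
Qed.

Lemma lonP k w j : Dyck k w -> 1 <= j <= k ->
  j + lon w j <= k /\
  lon w j < \sum_(j <= i < (j + lon w j).+1) nth 0 (gammas w) i.-1 /\
  (forall t, t < lon w j -> \sum_(j <= i < (j + t).+1) nth 0 (gammas w) i.-1 <= t).
Proof.
move=> Hw Hj; have [HU HD Hpre] := Hw.
set g := gammas w; set P := fun t => t < \sum_(j <= i < (j + t).+1) nth 0 g i.-1.
have Hg : size g = k by rewrite size_gammas.
have Ew : w = flatten [seq U :: nseq x D | x <- g].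
  by rewrite {1}(gammasK w) (Dyck_index Hw).
have Htot : sumn g = k by rewrite -HD Ew; case: (count_blocks g).
have Hpart : sumn (take j.-1 g) <= j.-1.
  pose w1 := flatten [seq U :: nseq x D | x <- take j.-1 g].
  have E : take (size w1) w = w1.
    by rewrite Ew -{1}(cat_take_drop j.-1 g) map_cat flatten_cat take_size_cat.
  move: (Hpre (size w1)); rewrite E.
  have [-> ->] := count_blocks (take j.-1 g).
  by move=> h; apply: (leq_trans h); rewrite size_take; case: ltnP => // /leq_trans; apply.
have Hk : P (k - j).
  rewrite /P; case/andP: Hj => j1 jk; rewrite subnKC //.
  have -> : \sum_(j <= i < k.+1) nth 0 g i.-1 = sumn (drop j.-1 g).
    rewrite sumnE [RHS](big_nth 0) size_drop Hg.
    rewrite -{1}(prednK j1) big_add1 /= -{1}[j.-1]add0n big_addn.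
    by apply: eq_bigr => i _; rewrite nth_drop addnC.
  have := congr1 sumn (cat_take_drop j.-1 g); rewrite sumn_cat Htot => E.
  rewrite -(ltn_add2l (sumn (take j.-1 g))) E.
  apply: (@leq_ltn_trans (j.-1 + (k - j))); first by rewrite leq_add2r.
  by rewrite -addSn prednK // subnKC.
have Hlt : k - j < k by rewrite ltn_subrL; case/andP: Hj => j1 /(leq_trans j1) ->; rewrite j1.
have Hhas : has P (iota 0 (size g)).
  by apply/hasP; exists (k - j); rewrite ?mem_iota ?Hg.
have El : lon w j = find P (iota 0 (size g)) by [].
have Hf : lon w j < size g by rewrite El -[X in _ < X](size_iota 0) -has_find.
have Hmin t : t < lon w j -> ~~ P t.
  move=> Ht; have := before_find 0 (a := P) (s := iota 0 (size g)) Ht.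
  by rewrite nth_iota ?(ltn_trans Ht) // add0n => ->.
have Hle : lon w j <= k - j by rewrite leqNgt; apply/negP => /Hmin; rewrite Hk.
split.
  by case/andP: Hj => _ jk; rewrite -[X in _ <= X](subnKC jk) leq_add2l.
split; last by move=> t /Hmin; rewrite -leqNgt.
by have := nth_find 0 Hhas; rewrite -El nth_iota // add0n.
Qed.

(* Main.v *)
(* A permutation avoiding 132 is the same thing as a plane forest read in postorder, every root
   being larger than its descendants and every tree larger than the trees to its right; [swl] keeps
   the forest but, at every root z with word X Y z and X > z > Y, exchanges the blocks X and Y,
   which yields a permutation avoiding 312. Preimages under the stack-sorting map split a word as A
   B n with A and B again sorted, and a sorted word of length n has at most (n-1)/2 descents, with
   equality exactly for uniquely sorted words. For 132-avoiding words, A is a subtree hanging from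
   the leftmost path of the forest, and an induction shows that the word is uniquely sorted iff in
   the corresponding tree every subtree has more leaves than internal nodes, the whole tree having
   exactly one more. In the preorder code of the tree, the first Dyck path lists the arities of the
   internal nodes (U D^(m-1) for arity m) and the second one tells internal nodes (U) from leaves
   (D). Comparing the longevity of a node in both paths is comparing the partial sums of m-2 with
   the partial counts of leaves minus internal nodes from that node on, and this translates the
   subtree condition into the Tamari order. *)
Require Import Defs.
From mathcomp Require Import all_boot zify.
From mathcomp Require Import classical_sets functions.

Set Implicit Arguments.
Unset Strict Implicit.
Unset Printing Implicit Defensive.

(** * Stack sorting *)

Definition sortable (w : seq nat) : Prop :=
  exists2 q, perm_word q & stack_sort q = w.

Lemma perm_word_max q : perm_word q -> q != [::] ->
  exists l m r, [/\ q = l ++ m :: r, all (gtn m) l & all (gtn m) r].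
Proof.
case/andP=> Uq _ q0; have Hm := max_word_mem q0.
have Hle x : x \in q -> x <= \max_(y <- q) y.
  by move=> Hx; exact: (@leq_bigmax_seq _ q xpredT id x).
move: (\max_(y <- q) y) Hm Hle => m Hm Hle.
case/splitPr: Hm Uq Hle => l r; rewrite uniq_catC /= mem_cat negb_or => /andP[/andP[Hr Hl] _] Hle.
exists l, m, r; split=> //; apply/allP => x Hx /=; rewrite ltn_neqAle Hle ?mem_cat ?inE ?Hx ?orbT // andbT.
  by apply: contraNneq Hl => <-.
by apply: contraNneq Hr => <-.
Qed.

Lemma stack_sort_split l m r : all (gtn m) l -> all (gtn m) r ->
  stack_sort (l ++ m :: r) = stack_sort l ++ stack_sort r ++ [:: m].
Proof. by move=> /allP Hl /allP Hr; apply: stack_sort_cat. Qed.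

Lemma perm_word_cat a b : perm_word (a ++ b) -> perm_word a /\ perm_word b.
Proof.
rewrite /perm_word cat_uniq mem_cat negb_or => /andP[/and3P[-> _ ->] /andP[-> ->]] //.
Qed.

Lemma perm_word_cons m r : perm_word (m :: r) -> perm_word r.
Proof. by rewrite -cat1s => /perm_word_cat[]. Qed.

Lemma perm_word_perm p q : perm_eq p q -> perm_word p = perm_word q.
Proof. by move=> H; rewrite /perm_word (perm_uniq H) (perm_mem H). Qed.

Lemma perm_stack_sort q : perm_word q -> perm_eq (stack_sort q) q.
Proof.
have [n] := ubnP (size q); elim: n q => // n IH q Hn Wq.
have [->//|q0] := eqVneq q [::].
have [l [m [r [Eq Hl Hr]]]] := perm_word_max Wq q0; subst q.
have [Wl /perm_word_cons Wr] := perm_word_cat Wq.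
rewrite size_cat /= in Hn.
rewrite stack_sort_split // perm_cat //; first by apply: IH => //; lia.
by rewrite cats1 perm_rcons perm_cons; apply: IH => //; lia.
Qed.

Lemma sortable_perm_word w : sortable w -> perm_word w.
Proof. by case=> q Wq <-; rewrite (perm_word_perm (perm_stack_sort Wq)). Qed.

Lemma sortable_nil : sortable [::].
Proof. by exists [::]. Qed.

Lemma sortable_inv w : sortable w -> w != [::] ->
  exists A B z, [/\ w = A ++ B ++ [:: z], sortable A, sortable B & all (gtn z) (A ++ B)].
Proof.
case=> q Wq <- w0.
have q0 : q != [::] by apply: contraNneq w0 => ->.
have [l [m [r [Eq Hl Hr]]]] := perm_word_max Wq q0; subst q.
have [Wl /perm_word_cons Wr] := perm_word_cat Wq.
exists (stack_sort l), (stack_sort r), m; split.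
- exact: stack_sort_split.
- by exists l.
- by exists r.
- by rewrite all_cat !(perm_all _ (perm_stack_sort _)) // Hl.
Qed.

Lemma sortable_cat_max A B z : perm_word (A ++ B ++ [:: z]) -> all (gtn z) (A ++ B) ->
  sortable A -> sortable B -> sortable (A ++ B ++ [:: z]).
Proof.
move=> W; rewrite all_cat => /andP[HA HB] [l Wl El] [r Wr Er]; subst A B.
have Hl := perm_stack_sort Wl; have Hr := perm_stack_sort Wr.
rewrite (perm_all _ Hl) in HA; rewrite (perm_all _ Hr) in HB.
exists (l ++ z :: r); last exact: stack_sort_split.
rewrite -(@perm_word_perm (stack_sort (l ++ z :: r))) ?stack_sort_split //.
by rewrite perm_cat // cats1 perm_rcons perm_cons.
Qed.

(** [A] is absorbed by the first nonempty block of [B], which starts with the first letter of [B],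
    and the induction applies to that block; if both blocks are empty, [A] itself becomes a
    block. *)
Lemma sortable_ascent A B b0 : sortable A -> sortable B -> B != [::] -> perm_word (A ++ B) ->
  all (gtn (head b0 B)) A -> sortable (A ++ B).
Proof.
have [n] := ubnP (size B); elim: n B => // n IH B Hn SA SB B0 W HA.
have [B1 [B2 [z [EB S1 S2 HB]]]] := sortable_inv SB B0; subst B.
have [_ W2] := perm_word_cat W.
rewrite !size_cat /= in Hn.
have HAz : all (gtn z) A.
  apply/allP => x /(allP HA) /=.
  case: (B1) (B2) HB => [|y B1'] [|y' B2'] //= /andP[+ _]; lia.
move: (HB); rewrite all_cat => /andP[HB1 HB2].
have [E1|N1] := eqVneq B1 [::].
  subst B1; have [E2|N2] := eqVneq B2 [::].
    subst B2; rewrite /= -[[:: z]]/([::] ++ [:: z]).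
    by apply: sortable_cat_max => //; rewrite all_cat HAz.
  rewrite /= catA -[[:: z]]/([::] ++ [:: z]).
  have HAB : all (gtn z) ((A ++ B2) ++ [::]) by rewrite cats0 all_cat HAz.
  apply: sortable_cat_max => //; first by rewrite -catA.
  apply: IH => //; first by move: Hn; clear; lia.
    by move: W; rewrite /= catA => /perm_word_cat[].
  by case: (B2) N2 HA => [|y B2'].
rewrite catA; apply: sortable_cat_max => //; first by rewrite -catA.
  by rewrite -catA all_cat HAz.
apply: IH => //; first by move: Hn; clear; lia.
  by move: W; rewrite catA => /perm_word_cat[].
by case: (B1) N1 HA => [|y B1'].
Qed.

(** Descents are recorded as steps because the paths of [DL] are such words: read backwards for the
    permutation, with letters exchanged for its rotation. *)
Definition cmp (a b : nat) : step := if b < a then D else U.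
Definition dsteps (w : seq nat) : seq step := if w is x :: s then pairmap cmp x s else [::].
Definition des (w : seq nat) : nat := count_mem D (dsteps w).

Lemma dsteps_cat x s y t :
  dsteps ((x :: s) ++ y :: t) = dsteps (x :: s) ++ cmp (last x s) y :: dsteps (y :: t).
Proof. by rewrite /= pairmap_cat. Qed.

Lemma size_dsteps w : size (dsteps w) = (size w).-1.
Proof. by case: w => //= x s; rewrite size_pairmap. Qed.

Lemma des_cat d a b : a != [::] -> b != [::] ->
  des (a ++ b) = des a + (head d b < last d a) + des b.
Proof.
case: a b => [|x s] [|y t] // _ _; rewrite /des dsteps_cat count_cat /= /cmp.
by case: ifP => _ /=; lia.
Qed.

Lemma des_rcons_max a z : all (gtn z) a -> des (a ++ [:: z]) = des a.
Proof.
case: a => // x s Ha; rewrite (@des_cat 0) //= addn0.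
have -> : (z < last x s) = false by have /= := allP Ha _ (mem_last x s); lia.
by rewrite addn0.
Qed.

(** Without the final maximum, a suffix lies in [B] or consists of a suffix of [A] and all of [B].
    In the second case each piece has one unit to spare, the two units pay for a descent at the
    junction, and the maximum makes the bound strict again. *)
Lemma sortable_suffix a b : sortable (a ++ b) -> b != [::] -> (des b).*2 < size b.
Proof.
have [n] := ubnP (size (a ++ b)); elim: n a b => // n IH a b Hn S b0.
have [|A [B [z [Ew SA SB Hz]]]] := sortable_inv S; first by case: (a) (b) b0 => [|? ?] [|? ?].
case/lastP: b b0 S Ew Hn => // b' z' _ S; rewrite -cats1 !catA => E Hn.
have [E1 Ez] : a ++ b' = A ++ B /\ z' = z.
  by move: E; rewrite !cats1 => /rcons_inj[].
subst z'; move: Hz; rewrite -E1 all_cat => /andP[_ Hz].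
rewrite des_rcons_max // size_cat addn1 ltnS.
have [->//|n0] := eqVneq b' [::].
have Hs : size a + size b' = size A + size B by rewrite -!size_cat E1.
rewrite !size_cat /= in Hn.
have [le|gt] := leqP (size b') (size B).
  have EB : B = drop (size A) a ++ b'.
    have := congr1 (drop (size A)) E1; rewrite (@drop_size_cat _ (size A) A B) // drop_cat => <-.
    case: ltnP => // h; have E0 : size a = size A by lia.
    by rewrite E0 subnn drop0 -E0 drop_size.
  apply: ltnW; apply: (IH (drop (size A) a)); rewrite -?EB //; lia.
have EA : A = a ++ take (size b' - size B) b'.
  have := congr1 (take (size A)) E1; rewrite (@take_size_cat _ (size A) A B) // take_cat.
  have -> : size A < size a = false by lia.
  by have -> : size b' - size B = size A - size a by lia.
have Eb : b' = take (size b' - size B) b' ++ B.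
  have := congr1 (drop (size A)) E1; rewrite (@drop_size_cat _ (size A) A B) // drop_cat.
  have -> : size A < size a = false by lia.
  have -> : size b' - size B = size A - size a by lia.
  by move=> <-; rewrite cat_take_drop.
set b'' := take _ _ in EA Eb.
have n'' : b'' != [::].
  by apply: contraTneq gt => E''; rewrite Eb E'' /= ltnn.
have HA : (des b'').*2 < size b'' by apply: (IH a) => //; rewrite -?EA //; lia.
rewrite Eb; have [->|nB] := eqVneq B [::]; first by rewrite cats0; lia.
have HB : (des B).*2 < size B by apply: (IH [::]) => //=; lia.
rewrite (@des_cat 0) // size_cat; case: (_ < _) => /=; lia.
Qed.

(** Equality in the bound of [sortable_suffix] for the whole word. *)
Definition tight (w : seq nat) : Prop := (des w).*2.+1 = size w.

(** The bounds for the two blocks leave no slack: both must be equalities and the junction must be a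
    descent. *)
Lemma tight_split A B z : sortable A -> sortable B -> all (gtn z) (A ++ B) -> A ++ B != [::] ->
  tight (A ++ B ++ [:: z]) ->
  [/\ A != [::], B != [::], tight A, tight B & head 0 B < last 0 A].
Proof.
move=> SA SB Hz n0; rewrite /tight catA des_rcons_max // size_cat addn1.
have HA := @sortable_suffix [::] A SA; have HB := @sortable_suffix [::] B SB.
have [EA|nA] := eqVneq A [::].
  by subst A; have := HB n0; rewrite /=; lia.
have [EB|nB] := eqVneq B [::].
  by subst B; have := HA nA; rewrite cats0; lia.
have {}HA := HA nA; have {}HB := HB nB.
rewrite (@des_cat 0) // size_cat; case: (head 0 B < last 0 A) => /=; last lia.
by move=> E; split=> //; lia.
Qed.

(* Otherwise B would have a tight suffix preceded by a descent, against [sortable_suffix]. *)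
Lemma tight_split_unique A B A' B' : sortable B -> A ++ B = A' ++ B' ->
  A' != [::] -> B' != [::] -> tight B' -> head 0 B' < last 0 A' -> size A' <= size A.
Proof.
move=> SB E nA nB TB Hd; rewrite leqNgt; apply/negP => lt.
have EA : A' = A ++ drop (size A) A'.
  have := congr1 (take (size A)) E; rewrite take_size_cat // take_cat lt => {1}->.
  by rewrite cat_take_drop.
have EB : B = drop (size A) A' ++ B'.
  by have := congr1 (drop (size A)) E; rewrite drop_size_cat // drop_cat lt.
set C := drop _ _ in EA EB.
have nC : C != [::] by apply: contraTneq lt => EC; rewrite EA EC cats0 ltnn.
case/lastP: C nC EA EB => // C c _ EA EB.
move: Hd; rewrite EA last_cat last_rcons => Hd.
have := @sortable_suffix C (c :: B').
rewrite -cat_rcons -EB => /(_ SB isT); rewrite -cat1s (@des_cat 0) //= Hd.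
rewrite /tight in TB; have -> : des [:: c] = 0 by []. lia.
Qed.

(** [tight_split_unique], used in both directions, makes the two splittings of the image coincide,
    and the induction applies to each block. *)
Lemma tight_preimage_unique q q' : perm_word q -> perm_word q' ->
  tight (stack_sort q) -> stack_sort q = stack_sort q' -> q = q'.
Proof.
have [n] := ubnP (size q); elim: n q q' => // n IH q q' Hn Wq Wq' T E.
have Hs : size q = size q'.
  by rewrite -(perm_size (perm_stack_sort Wq)) E (perm_size (perm_stack_sort Wq')).
have [E0|q0] := eqVneq q [::].
  by subst q; case: (q') Hs.
have q0' : q' != [::] by case: (q) (q') Hs q0 => [|? ?] [|? ?].
have [l [m [r [Eq Hl Hr]]]] := perm_word_max Wq q0; subst q.
have [l' [m' [r' [Eq Hl' Hr']]]] := perm_word_max Wq' q0'; subst q'.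
have [Wl /perm_word_cons Wr] := perm_word_cat Wq.
have [Wl' /perm_word_cons Wr'] := perm_word_cat Wq'.
have sl := perm_stack_sort Wl; have sr := perm_stack_sort Wr.
have sl' := perm_stack_sort Wl'; have sr' := perm_stack_sort Wr'.
have Sl : sortable (stack_sort l) by exists l.
have Sr : sortable (stack_sort r) by exists r.
have Sl' : sortable (stack_sort l') by exists l'.
have Sr' : sortable (stack_sort r') by exists r'.
move: (E) T; rewrite !stack_sort_split // => E1 T.
have T' := T; rewrite E1 in T'.
have [E2 Em] : stack_sort l ++ stack_sort r = stack_sort l' ++ stack_sort r' /\ m = m'.
  by move: E1; rewrite !catA !cats1 => /rcons_inj[].
subst m'.
have Hz : all (gtn m) (stack_sort l ++ stack_sort r).
  by rewrite all_cat (perm_all _ sl) (perm_all _ sr) Hl.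
have [N|N] := eqVneq (stack_sort l ++ stack_sort r) [::].
  have N' := N; rewrite E2 in N'.
  have Hnil a b : perm_eq (stack_sort a) a -> perm_eq (stack_sort b) b ->
      stack_sort a ++ stack_sort b = [::] -> a = [::] /\ b = [::].
    move=> Ha Hb /(congr1 size); rewrite size_cat (perm_size Ha) (perm_size Hb).
    by case: (a) (b) => [|? ?] [|? ?].
  have [-> ->] := Hnil _ _ sl sr N; by have [-> ->] := Hnil _ _ sl' sr' N'.
have [n1 n2 t1 t2 d1] := tight_split Sl Sr Hz N T.
have Hz' := Hz; rewrite E2 in Hz'; have N' := N; rewrite E2 in N'.
have [n1' n2' t1' t2' d1'] := tight_split Sl' Sr' Hz' N' T'.
have le1 := tight_split_unique Sr E2 n1' n2' t2' d1'.
have le2 := tight_split_unique Sr' (esym E2) n1 n2 t2 d1.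
have Es : size (stack_sort l) = size (stack_sort l') by apply/eqP; rewrite eqn_leq le1 le2.
move/eqP: E2; rewrite eqseq_cat // => /andP[/eqP El /eqP Er].
rewrite size_cat /= in Hn.
have [ltl ltr] : size l < n /\ size r < n by move: Hn; clear; lia.
by rewrite (IH _ _ ltl Wl Wl' t1 El) (IH _ _ ltr Wr Wr' t2 Er).
Qed.

Lemma tight_uniquely_sorted w : sortable w -> tight w -> uniquely_sorted w.
Proof.
move=> [q Wq Eq] T; exists q; split=> // q' [Wq' Eq'].
by apply: tight_preimage_unique; rewrite ?Eq.
Qed.

Lemma uniquely_sorted_sortable w : uniquely_sorted w -> sortable w.
Proof. by case=> q [[]]; exists q. Qed.

(** The letter [z] can be put before or after a preimage of [A], which gives two preimages. *)
Lemma uniquely_sorted_rcons A z : A != [::] -> all (gtn z) A -> sortable A ->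
  ~ uniquely_sorted (A ++ [:: z]).
Proof.
move=> A0 HA [l Wl El] [q [[Wq Eq] Uq]].
have sl := perm_stack_sort Wl; rewrite El in sl.
have Hl : all (gtn z) l by rewrite -(perm_all _ sl).
have E1 : stack_sort (l ++ [:: z]) = A ++ [:: z] by rewrite stack_sort_split //= El.
have E2 : stack_sort ([::] ++ z :: l) = A ++ [:: z] by rewrite stack_sort_split //= El.
have W : perm_word (A ++ [:: z]).
  by rewrite -Eq (perm_word_perm (perm_stack_sort Wq)).
have W1 : perm_word (l ++ [:: z]).
  by rewrite -(@perm_word_perm (A ++ [:: z])) // perm_cat.
have W2 : perm_word (z :: l).
  by rewrite -(@perm_word_perm (A ++ [:: z])) // cats1 perm_rcons perm_cons.
have := Uq _ (conj W2 E2); rewrite (Uq _ (conj W1 E1)).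
case: (l) (perm_size sl) Hl => [/size0nil EA|x l'] /=; first by rewrite EA in A0.
by move=> _ /andP[lt _] [Ex _]; rewrite Ex ltnn in lt.
Qed.

(** A second preimage of a block would give a second preimage of [w]. With an empty block or an
    ascent at the junction, the word without its maximum would be sortable, against
    [uniquely_sorted_rcons]. *)
Lemma uniquely_sorted_inv w : uniquely_sorted w -> 1 < size w ->
  exists A B z, [/\ w = A ++ B ++ [:: z], all (gtn z) (A ++ B),
    uniquely_sorted A, uniquely_sorted B & [/\ A != [::], B != [::] & head 0 B < last 0 A]].
Proof.
move=> Uw sw; have W := sortable_perm_word (uniquely_sorted_sortable Uw).
case: (Uw) => q [[Wq Eq] Uq].
have w0 : w != [::] by case: (w) sw.
have q0 : q != [::] by apply: contraNneq w0 => E0; rewrite -Eq E0.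
have [l [m [r [E Hl Hr]]]] := perm_word_max Wq q0; subst q.
have [Wl /perm_word_cons Wr] := perm_word_cat Wq.
have sl := perm_stack_sort Wl; have sr := perm_stack_sort Wr.
have Hz : all (gtn m) (stack_sort l ++ stack_sort r).
  by rewrite all_cat (perm_all _ sl) (perm_all _ sr) Hl.
have Ew : w = stack_sort l ++ stack_sort r ++ [:: m] by rewrite -Eq stack_sort_split.
have N : stack_sort l ++ stack_sort r != [::].
  by apply: contraTneq sw => E0; rewrite Ew catA E0.
have Nsort : ~ sortable (stack_sort l ++ stack_sort r).
  by move=> S; apply: (uniquely_sorted_rcons N Hz S); rewrite -catA -Ew.
have nA : stack_sort l != [::].
  by apply/eqP => E0; apply: Nsort; rewrite E0; exists r.
have nB : stack_sort r != [::].
  by apply/eqP => E0; apply: Nsort; rewrite E0 cats0; exists l.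
have Sl : sortable (stack_sort l) by exists l.
have Sr : sortable (stack_sort r) by exists r.
exists (stack_sort l), (stack_sort r), m; split=> //.
- exists l; split=> // l2 [Wl2 El2].
  have sl2 := perm_stack_sort Wl2; rewrite El2 in sl2.
  have s2 : perm_eq l l2 by rewrite -(permPl sl).
  have Hl2 : all (gtn m) l2 by rewrite -(perm_all _ s2).
  have /eqP : l ++ m :: r = l2 ++ m :: r.
    apply: Uq; rewrite stack_sort_split // El2 -Ew; split=> //.
    by rewrite -(@perm_word_perm (l ++ m :: r)) // perm_cat.
  by rewrite eqseq_cat ?(perm_size s2) // => /andP[/eqP].
- exists r; split=> // r2 [Wr2 Er2].
  have sr2 := perm_stack_sort Wr2; rewrite Er2 in sr2.
  have s2 : perm_eq r r2 by rewrite -(permPl sr).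
  have Hr2 : all (gtn m) r2 by rewrite -(perm_all _ s2).
  have /eqP : l ++ m :: r = l ++ m :: r2.
    apply: Uq; rewrite stack_sort_split // Er2 -Ew; split=> //.
    by rewrite -(@perm_word_perm (l ++ m :: r)) // perm_cat // perm_cons.
  by rewrite eqseq_cat // eqxx /= => /eqP[].
- split=> //; rewrite ltnNge; apply/negP => le; apply: Nsort.
  have Wlr : perm_word (stack_sort l ++ stack_sort r).
    by move: W; rewrite Ew catA => /perm_word_cat[].
  apply: (@sortable_ascent _ _ 0) => //.
  (* The first block ends with its maximum, so an ascent at the junction puts the whole block below
     the first letter of the second one, as [sortable_ascent] requires. *)
  have [A1 [A2 [a [EA _ _ HA]]]] := sortable_inv Sl nA.
  have ltA : last 0 (stack_sort l) < head 0 (stack_sort r).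
    rewrite ltn_neqAle le andbT; apply/eqP => Eab.
    case/andP: Wlr; rewrite cat_uniq => /and3P[_ /hasP h _] _; apply: h.
    exists (head 0 (stack_sort r)); first by case: (stack_sort r) nB => //= x s _; rewrite mem_head.
    by rewrite -Eab /=; case: (stack_sort l) nA => //= x s _; rewrite mem_last.
  move: ltA; rewrite EA !last_cat /= => lta; rewrite catA all_cat /= lta andbT.
  rewrite andbT; apply: sub_all HA => x /=; move: lta; move: (head _ _) => h; clear; lia.
Qed.

(** * Plane forests and uniquely sorted words *)

(* [Snoc X Y] is the plane forest X followed by a tree whose root has the forest Y as children. *)
Inductive forest := NoTree | Snoc of forest & forest.

Definition is_empty (T : forest) : bool := if T is NoTree then true else false.

Fixpoint fint (T : forest) : nat :=
  if T is Snoc X Y then fint X + fint Y + ~~ is_empty Y else 0.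

(* Number of leaves minus number of internal nodes; the subtractions do not truncate when [good T]. *)
Fixpoint exc (T : forest) : nat :=
  if T is Snoc X Y then exc X + (if is_empty Y then 1 else (exc Y).-1) else 0.

(* Every subtree has more leaves than internal nodes. *)
Fixpoint good (T : forest) : bool :=
  if T is Snoc X Y then [&& good X, good Y & is_empty Y || (1 < exc Y)] else true.

Fixpoint shape132 (T : forest) (w : seq nat) : Prop :=
  if T is Snoc X Y then
    exists x y z, [/\ w = x ++ y ++ [:: z], shape132 X x, shape132 Y y,
      all (ltn z) x & all (gtn z) y]
  else w = [::].

Fixpoint shape312 (T : forest) (w : seq nat) : Prop :=
  if T is Snoc X Y then
    exists x y z, [/\ w = y ++ x ++ [:: z], shape312 X x, shape312 Y y,
      all (ltn z) x & all (gtn z) y]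
  else w = [::].

Lemma good_exc T : good T -> ~~ is_empty T -> 0 < exc T.
Proof.
by case: T => //= X Y /and3P[_ _]; case: is_empty => //=; lia.
Qed.

(** Each tree of a good forest contributes at least 1 to the excess. *)
Lemma good_single T : good T -> exc T = 1 -> exists Y, T = Snoc NoTree Y.
Proof.
case: T => // X Y /= /and3P[gX gY hY] e; exists Y.
case: X gX e => // X1 X2 gX; have := good_exc gX isT.
by case: is_empty hY => /=; lia.
Qed.

Lemma shape132_empty T w : shape132 T w -> (w == [::]) = is_empty T.
Proof.
by case: T => [->//|X Y [x [y [z [-> _ _ _ _]]]]]; case: x y => [|? ?] [|? ?].
Qed.

Lemma shape312_empty T w : shape312 T w -> (w == [::]) = is_empty T.
Proof.
by case: T => [->//|X Y [x [y [z [-> _ _ _ _]]]]]; case: x y => [|? ?] [|? ?].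
Qed.

Fixpoint fsize (T : forest) : nat :=
  if T is Snoc X Y then fsize X + fsize Y + 1 else 0.

Lemma shape132_size T w : shape132 T w -> size w = fsize T.
Proof.
elim: T w => [_ -> //|X IX Y IY] w [x [y [z [-> /IX Ex /IY Ey _ _]]]] /=.
by rewrite !size_cat /=; lia.
Qed.

Lemma shape312_size T w : shape312 T w -> size w = fsize T.
Proof.
elim: T w => [_ -> //|X IX Y IY] w [x [y [z [-> /IX Ex /IY Ey _ _]]]] /=.
by rewrite !size_cat /=; lia.
Qed.

Lemma exc_fsize T : good T -> exc T + (fint T).*2 = fsize T.
Proof.
elim: T => //= X IX Y IY /and3P[/IX <- gY]; move: (IY gY).
by case: Y gY {IY} => [|Y1 Y2] _ /=; lia.
Qed.

Lemma ltn_allP z x y : all (ltn z) x -> all (gtn z) y -> {in x & y, forall a b, b < a}.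
Proof.
by move=> /allP Hx /allP Hy a b /Hx /= + /Hy /=; lia.
Qed.

Lemma head_mem (s : seq nat) : s != [::] -> head 0 s \in s.
Proof.
by case: s => //= x s _; rewrite mem_head.
Qed.

Lemma last_mem (s : seq nat) : s != [::] -> last 0 s \in s.
Proof.
by case: s => //= x s _; rewrite mem_last.
Qed.

Lemma des_rcons_min a z : a != [::] -> all (ltn z) a -> des (a ++ [:: z]) = (des a).+1.
Proof.
move=> a0 /allP Ha; rewrite (@des_cat 0) //=.
have -> : z < last 0 a := Ha _ (last_mem a0).
by rewrite /des /= addn0 addn1.
Qed.

(** Ascents correspond to internal nodes: the only ascent between the blocks of [x ++ y ++ [:: z]]
    goes from the last child in [y] to its parent [z]. *)
Lemma shape132_des T w : shape132 T w -> w != [::] -> des w + fint T + 1 = size w.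
Proof.
elim: T w => [_ -> //|X IX Y IY] w [x [y [z [-> Sx Sy Hx Hy]]]] _ /=.
rewrite -(shape132_empty Sy).
have {}IX := IX _ Sx; have {}IY := IY _ Sy.
have [Ey|ny] := eqVneq y [::].
  subst y; have -> : Y = NoTree by case: (Y) (shape132_empty Sy).
  have [Ex|nx] := eqVneq x [::].
    by subst x; have -> : X = NoTree by case: (X) (shape132_empty Sx).
  by rewrite /= des_rcons_min // size_cat /=; have := IX nx; lia.
have [Ex|nx] := eqVneq x [::].
  subst x; have -> : X = NoTree by case: (X) (shape132_empty Sx).
  by rewrite /= des_rcons_max // size_cat /=; have := IY ny; lia.
rewrite (@des_cat 0) //; last by case: (y).
have -> : head 0 (y ++ [:: z]) = head 0 y by case: (y) ny.
rewrite (ltn_allP Hx Hy) ?last_mem ?head_mem //= des_rcons_max // !size_cat /=.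
by have := IX nx; have := IY ny; lia.
Qed.

(** Here the ascent due to an internal node is the one that leaves the word [y] of its
    descendants. *)
Lemma shape312_des T w : shape312 T w -> w != [::] -> des w + fint T + 1 = size w.
Proof.
elim: T w => [_ -> //|X IX Y IY] w [x [y [z [-> Sx Sy Hx Hy]]]] _ /=.
rewrite -(shape312_empty Sy).
have {}IX := IX _ Sx; have {}IY := IY _ Sy.
have [Ex|nx] := eqVneq x [::].
  subst x; have -> : X = NoTree by case: (X) (shape312_empty Sx).
  have [Ey|ny] := eqVneq y [::].
    by subst y; have -> : Y = NoTree by case: (Y) (shape312_empty Sy).
  by rewrite /= des_rcons_max // size_cat /=; have := IY ny; lia.
have [Ey|ny] := eqVneq y [::].
  subst y; have -> : Y = NoTree by case: (Y) (shape312_empty Sy).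
  by rewrite /= des_rcons_min // size_cat /=; have := IX nx; lia.
rewrite (@des_cat 0) //; last by case: (x).
have -> : head 0 (x ++ [:: z]) = head 0 x by case: (x) nx.
have := ltn_allP Hx Hy (head_mem nx) (last_mem ny).
rewrite des_rcons_min // !size_cat /= => h.
have -> : head 0 x < last 0 y = false by lia.
by have := IX nx; have := IY ny; lia.
Qed.

Lemma shape132_tight T w : shape132 T w -> good T -> exc T = 1 -> tight w.
Proof.
move=> S g e; have w0 : w != [::] by rewrite (shape132_empty S); case: (T) e.
by have := shape132_des S w0; have := exc_fsize g; rewrite /tight -(shape132_size S); lia.
Qed.

Lemma shape312_tight T w : shape312 T w -> good T -> exc T = 1 -> tight w.
Proof.
move=> S g e; have w0 : w != [::] by rewrite (shape312_empty S); case: (T) e.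
by have := shape312_des S w0; have := exc_fsize g; rewrite /tight -(shape312_size S); lia.
Qed.

Lemma cat_split (T : Type) (a b c d : seq T) : a ++ b = c ++ d -> size a <= size c ->
  exists e, c = a ++ e /\ b = e ++ d.
Proof.
move=> E le; exists (drop (size a) c); split.
  have := congr1 (take (size a)) E; rewrite take_size_cat // takel_cat // => {1}->.
  by rewrite cat_take_drop.
have := congr1 (drop (size a)) E; rewrite drop_size_cat // drop_cat => ->.
case: ltnP => // le2. have E2 : size a = size c by lia. by rewrite E2 subnn drop_size drop0.
Qed.

(** Since [A] ends with its maximum, it is the word of a subtree on the leftmost path: the induction
    goes into the first trees [X] or, when there are none, into the children [Y]. The descent after
    [A] says that its root is not an only child, so its parent stays internal when the subtree is
    cut off, and the excesses add up. *)
Lemma shape132_merge T A B : shape132 T (A ++ B) -> A != [::] -> B != [::] ->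
  all (geq (last 0 A)) A -> head 0 B < last 0 A ->
  exists TA TB, [/\ shape132 TA A, shape132 TB B &
    good TA -> good TB -> good T /\ exc T = exc TA + exc TB].
Proof.
elim: T A B => [|X IX Y IY] A B.
  by move=> E + _; case: A E.
case=> x [y [z [E Sx Sy Hx Hy]]] nA nB MA dAB.
have [le|gt] := leqP (size A) (size x).
  have [e [Ex EB]] := cat_split E le; subst x.
  have [Ee|ne] := eqVneq e [::].
    subst e; rewrite cats0 in Sx; rewrite /= in EB.
    exists X, (Snoc NoTree Y); split=> //; first by exists [::], y, z.
    by move=> /= -> /andP[-> ->].
  have [|TA [TB [SA SB H]]] := IX A e Sx nA ne MA.
    by move: dAB; rewrite EB; case: (e) ne.
  exists TA, (Snoc TB Y); split=> //.
    by exists e, y, z; split=> //; move: Hx; rewrite all_cat => /andP[].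
  move=> gA /= /and3P[gB -> ->]; have [-> ->] := H gA gB; split=> //; lia.
have [e [EA Ee]] := cat_split (esym E) (ltnW gt).
have ne : e != [::] by apply: contraTneq gt => E0; rewrite EA E0 cats0 ltnn.
have [Ex|nx] := eqVneq x [::]; last first.
  (* If [A] overran a nonempty [x], its last letter would be at most [z] and hence smaller than the
     letters of [x], against its maximality. *)
  have mE : last 0 A \in y ++ [:: z].
    by rewrite Ee EA last_cat mem_cat; case: (e) ne => //= a s _; rewrite mem_last.
  have := allP MA (head 0 x); rewrite EA mem_cat head_mem // -EA => /(_ isT) /=.
  have := allP Hx _ (head_mem nx) => /=.
  move: mE; rewrite mem_cat inE => /orP[/(allP Hy) /= | /eqP->]; lia.
subst x; rewrite /= in EA; subst e.
have EX : X = NoTree by case: (X) (shape132_empty Sx).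
subst X; case/lastP: B nB dAB E Ee => // B b _ dAB E Ee.
have {Ee} [Ey Ez] : y = A ++ B /\ z = b.
  by move: Ee; rewrite -rcons_cat cats1 => /rcons_inj[].
subst z; have [EB|nB] := eqVneq B [::].
  move: dAB; rewrite EB /= => lt; exfalso.
  have /(allP Hy) /= : last 0 A \in y by rewrite Ey mem_cat last_mem.
  lia.
have dB : head 0 B < last 0 A by move: dAB; case: (B) nB.
subst y; have [TA [TB [SA SB H]]] := IY A B Sy nA nB MA dB.
have nTB : is_empty TB = false by rewrite -(shape132_empty SB) (negbTE nB).
have nTA : is_empty TA = false by rewrite -(shape132_empty SA) (negbTE nA).
have nY : is_empty Y = false by rewrite -(shape132_empty Sy); case: (A) nA.
exists TA, (Snoc NoTree TB); split=> //.
  by exists [::], B, b; rewrite cats1; split=> //; move: Hy; rewrite all_cat => /andP[].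
move=> gA /=; rewrite nTB nY /= => /andP[gB eB].
have [-> ->] := H gA gB; have := good_exc gA; rewrite nTA => /(_ isT); move: eB; clear; split; lia.
Qed.

(** The last letter is the maximum, so there is a single tree. By induction its two blocks have
    excess 1, its children have excess 2, and the root takes one off. *)
Lemma uniquely_sorted_shape T w : uniquely_sorted w -> w != [::] -> shape132 T w ->
  good T /\ exc T = 1.
Proof.
have [n] := ubnP (size w); elim: n w T => // n IH w T Hn Uw w0 S.
have [A0 [B0 [z0 [E0 _ _ H0]]]] := sortable_inv (uniquely_sorted_sortable Uw) w0.
case: T S => [E|X Y]; first by rewrite E in w0.
case=> x [y [z [Ew Sx Sy Hx Hy]]].
have [Exy Ez] : x ++ y = A0 ++ B0 /\ z = z0.
  by move: E0; rewrite Ew !catA !cats1 => /rcons_inj[].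
have EX : X = NoTree.
  case: (X) Sx (shape132_empty Sx) => // X1 X2 _ /= nx; exfalso.
  have hx : head 0 x \in x by apply: head_mem; rewrite nx.
  have := allP Hx _ hx; have := allP H0 (head 0 x).
  rewrite -Exy mem_cat hx /= -Ez => /(_ isT); lia.
subst X; rewrite /= in Sx; subst x; rewrite /= in Exy Ew.
have [Ey|ny] := eqVneq y [::].
  by have -> : Y = NoTree by case: (Y) (shape132_empty Sy); rewrite Ey.
have sw : 1 < size w by rewrite Ew size_cat; case: (y) ny => //= *; lia.
have [A [B [z1 [E1 Hz1 UA UB [nA nB dAB]]]]] := uniquely_sorted_inv Uw sw.
have [Ey Ez1] : y = A ++ B /\ z = z1.
  by move: E1; rewrite Ew !catA !cats1 => /rcons_inj[].
rewrite Ey in Sy ny Ew; have MA : all (geq (last 0 A)) A.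
  have [A1 [A2 [a [EA _ _ HA]]]] := sortable_inv (uniquely_sorted_sortable UA) nA.
  rewrite EA !last_cat /= catA all_cat /= leqnn !andbT.
  by apply: sub_all HA => v /=; lia.
have [TA [TB [SA SB H]]] := shape132_merge Sy nA nB MA dAB.
rewrite Ew !size_cat /= in Hn.
have [ltA ltB] : size A < n /\ size B < n by move: Hn; clear; lia.
have [gA eA] := IH A TA ltA UA nA SA.
have [gB eB] := IH B TB ltB UB nB SB.
have [gY eY] := H gA gB.
have nY : is_empty Y = false by rewrite -(shape132_empty Sy); apply: negbTE.
by rewrite /= nY gY eY eA eB.
Qed.

(* A is the topmost subtree of excess 1 on the leftmost path of T. *)
Lemma shape132_cut T w : shape132 T w -> good T -> ~~ is_empty T ->
  exists TA TB A B, [/\ w = A ++ B, shape132 TA A, shape132 TB B, good TA & good TB] /\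
    exc TA = 1 /\ exc T = exc TB + 1.
Proof.
elim: T w => [//|X IX Y IY] w [x [y [z [-> Sx Sy Hx Hy]]]] /= /and3P[gX gY hY] _.
have [nX|] := boolP (is_empty X); last first.
  move=> nX; have [TA [TB [A [B [[Ex SA SB gA gB] [eA eB]]]]]] := IX _ Sx gX nX.
  exists TA, (Snoc TB Y), A, (B ++ y ++ [:: z]); split; last by split=> //=; lia.
  split=> //; first by rewrite Ex -catA.
    exists B, y, z; split=> //; by move: Hx; rewrite Ex all_cat => /andP[].
  by rewrite /= gB gY.
have {nX} EX : X = NoTree by case: (X) nX.
subst X; rewrite /= in Sx; subst x.
have [lt|ge] := ltnP (if is_empty Y then 1 else (exc Y).-1) 2.
  exists (Snoc NoTree Y), NoTree, (y ++ [:: z]), [::]; rewrite cats0 /=.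
  have e1 : (if is_empty Y then 1 else (exc Y).-1) = 1.
    by case: is_empty hY lt => //=; lia.
  rewrite e1; split=> //; split=> //; last by rewrite gY hY.
  by exists [::], y, z.
case EY: (is_empty Y) ge hY => //= ge hY.
have [|TA [TB [A [B [[Ey SA SB gA gB] [eA eB]]]]]] := IY _ Sy gY; first by rewrite EY.
have nTB : is_empty TB = false by case: (TB) eB => //=; lia.
exists TA, (Snoc NoTree TB), A, (B ++ [:: z]); rewrite /= nTB; split; last by split=> //; lia.
split=> //; first by rewrite Ey -catA.
  by exists [::], B, z; split=> //; move: Hy; rewrite Ey all_cat => /andP[].
by rewrite gB /=; lia.
Qed.

(** The children of the root have excess 2, which [shape132_cut] divides into two forests of excess
    1; their words are the two blocks. *)
Lemma shape132_sortable T w : perm_word w -> shape132 T w -> good T -> exc T = 1 -> sortable w.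
Proof.
have [n] := ubnP (size w); elim: n w T => // n IH w T Hn W S g e.
have [Y ET] := good_single g e; subst T.
case: S => x [y [z [Ew Ex Sy _ Hy]]]; rewrite /= in Ex; subst x.
rewrite /= in Ew; subst w; move: g e => /= /andP[gY hY].
case EY: (is_empty Y) => /= e.
  have Ey : y = [::] by apply/eqP; rewrite (shape132_empty Sy).
  rewrite Ey in W *; rewrite -[[:: z]]/([::] ++ [::] ++ [:: z]).
  by apply: sortable_cat_max => //; apply: sortable_nil.
have [|TA [TB [A [B [[Ey SA SB gA gB] [eA eB]]]]]] := shape132_cut Sy gY; first by rewrite EY.
rewrite size_cat Ey size_cat /= in Hn; rewrite Ey -catA in W *.
have [WA WB] := perm_word_cat W; have [{}WB _] := perm_word_cat WB.
apply: sortable_cat_max => //; first by rewrite -Ey.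
  by apply: (IH _ TA) => //; lia.
by apply: (IH _ TB) => //; lia.
Qed.

(** A prefix that overruns [y] contains all of it. There [exc Y] > 1 improves the bound by one, to
    [size y <= (des y).*2], and this pays for the ascent after [y]. *)
Lemma shape312_prefix T w a b : shape312 T w -> good T -> w = a ++ b -> a != [::] ->
  size a <= (des a).*2.+1.
Proof.
elim: T w a b => [|X IX Y IY] w a b.
  by move=> -> _; case: a.
case=> x [y [z [-> Sx Sy Hx Hy]]] /= /and3P[gX gY hY] E na.
have [le|gt] := leqP (size a) (size y).
  have [e [Ey _]] := cat_split (esym E) le.
  exact: (IY _ a e Sy gY Ey).
have [e [Ea Ee]] := cat_split E (ltnW gt).
have ne : e != [::] by apply: contraTneq gt => E0; rewrite Ea E0 cats0 ltnn.
have desx : x != [::] -> size x <= (des x).*2.+1.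
  by move=> nx; apply: (IX x x [::]); rewrite ?cats0.
have Hee : size e <= (des e).*2.+1 /\ (y != [::] -> head 0 e < last 0 y = false).
  have [le2|gt2] := leqP (size e) (size x).
    have [f [Ex _]] := cat_split (esym Ee) le2; split.
      exact: (IX _ e f Sx gX Ex).
    move=> ny; have he : head 0 e \in x by rewrite Ex mem_cat head_mem.
    by have := ltn_allP Hx Hy he (last_mem ny); lia.
  have [f [Ex Ef]] := cat_split Ee (ltnW gt2).
  have Ef1 : f = [:: z] /\ b = [::].
    have nf : f != [::] by apply: contraTneq gt2 => E0; rewrite Ex E0 cats0 ltnn.
    by case: (f) nf Ef => // f0 [|? ?] _ //= [-> ].
  case: Ef1 => Ef1 _; subst f; have [E0|nx] := eqVneq x [::].
    subst x; rewrite Ex /=; split=> // ny.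
    by have := allP Hy _ (last_mem ny) => /=; lia.
  split.
    by rewrite Ex des_rcons_min // size_cat /= addn1 ltnS; move: (desx nx); clear; lia.
  move=> ny; have := ltn_allP Hx Hy (head_mem nx) (last_mem ny).
  by rewrite Ex; case: (x) nx => //= *; lia.
case: Hee => He Hd; have [Ey|ny] := eqVneq y [::].
  by rewrite Ea Ey.
rewrite Ea (@des_cat 0) // size_cat (Hd ny).
have nY : is_empty Y = false by rewrite -(shape312_empty Sy) (negbTE ny).
have := shape312_des Sy ny; have := exc_fsize gY; rewrite -(shape312_size Sy).
by move: hY; rewrite nY /=; lia.
Qed.

(** The complementary prefix is taken with the first letter of [b] included, so that the two pieces
    together count every descent of [w] exactly once. *)
Lemma shape312_suffix T w a b : shape312 T w -> good T -> exc T = 1 -> w = a ++ b -> b != [::] ->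
  (des b).*2 < size b.
Proof.
move=> S g e E nb; have t := shape312_tight S g e; rewrite /tight E in t.
have [Ea|na] := eqVneq a [::]; first by move: t; rewrite Ea /=; lia.
case: b nb E t => // b0 b _ E; rewrite (@des_cat 0) // size_cat => t.
have := @shape312_prefix T w (a ++ [:: b0]) b S g; rewrite -catA => /(_ E).
rewrite (@des_cat 0) // size_cat /=; case: (a) na t => //= a0 a' _ t /(_ isT).
by have -> : des [:: b0] = 0 by []; lia.
Qed.

Definition no312 (w : seq nat) : Prop :=
  forall c a b, subseq [:: c; a; b] w -> a < b -> b < c -> False.

Lemma des_decreasing m r : all (gtn m) r -> uniq r ->
  (forall a b, subseq [:: a; b] r -> a < b -> False) -> des (m :: r) = size r.
Proof.
elim: r m => [|x r IH] m //= /andP[ltx Hr] /andP[Ux Ur] N.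
rewrite -[m :: x :: r]cat1s (@des_cat 0) //= ltx IH //.
- apply/allP => y Hy /=; rewrite ltn_neqAle.
  have -> : y != x by apply: contraNneq Ux => <-.
  rewrite leqNgt; apply/negP => lt; apply: (N x y) => //.
  by rewrite /= eqxx sub1seq.
- by move=> a b sab; apply: N; apply: subseq_trans sab (subseq_cons _ _).
Qed.

(** By avoidance of 312 the word decreases after its maximum, and a decreasing suffix of more than
    one letter has too many descents. *)
Lemma no312_max_last w : perm_word w -> no312 w -> w != [::] ->
  (forall a b, w = a ++ b -> b != [::] -> (des b).*2 < size b) ->
  exists w' z, w = w' ++ [:: z] /\ all (gtn z) w'.
Proof.
move=> W N w0 B; have [l [m [r [Ew Hl Hr]]]] := perm_word_max W w0.
have [_ /perm_word_cons/andP[Ur _]] : perm_word l /\ perm_word (m :: r).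
  by apply: perm_word_cat; rewrite -Ew.
have := B l (m :: r) Ew isT; rewrite des_decreasing //.
  by rewrite /=; case: (r) Ew => [Ew _|? ? _ /=]; [exists l, m | lia].
move=> a b sab lab; apply: (N m a b _ lab).
  rewrite Ew; apply: subseq_trans (suffix_subseq _ _).
  by rewrite /= eqxx.
have /(allP Hr) // : b \in r.
by apply: (mem_subseq sab); rewrite !inE eqxx orbT.
Qed.

(* The second block is the shortest suffix of [w'] whose size is twice its number of descents, without
   its first letter; avoidance of 312 forces both blocks to end with their maximum. *)
Lemma no312_sortable w : perm_word w -> no312 w -> w != [::] -> tight w ->
  (forall a b, w = a ++ b -> b != [::] -> (des b).*2 < size b) -> sortable w.
Proof.
have [n] := ubnP (size w); elim: n w => // n IH w Hn W N w0 t B.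
have [w' [z [Ew Hz]]] := no312_max_last W N w0 B.
have B' b a : w' = a ++ b -> b != [::] -> (des b).*2 <= size b.
  move=> E nb; have := B a (b ++ [:: z]); rewrite Ew E -catA => /(_ erefl).
  rewrite des_rcons_max ?size_cat ?addn1 ?ltnS; first by apply; case: (b).
  by move: Hz; rewrite E all_cat => /andP[].
have [E0|n0] := eqVneq w' [::].
  rewrite Ew E0 in W *; rewrite -[[:: z]]/([::] ++ [::] ++ [:: z]).
  by apply: sortable_cat_max => //; apply: sortable_nil.
have t' : (des w').*2 = size w'.
  by move: t; rewrite /tight Ew des_rcons_max // size_cat /=; lia.
(* Index 0 qualifies because [w] is tight, so there is a last index; the suffixes that start after
   it satisfy the strict bound. *)
pose P i := (i < size w') && ((des (drop i w')).*2 == size (drop i w')).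
have exP : exists i, P i by exists 0; rewrite /P drop0 t' eqxx andbT lt0n size_eq0.
have ubP i : P i -> i <= size w' by case/andP=> /ltnW.
case: (ex_maxnP exP ubP) => i /andP[lti /eqP Pi] maxi.
rewrite (drop_nth 0 lti) in Pi; set c := nth 0 w' i in Pi.
set Bs := drop i.+1 w' in Pi.
have EwB : w' = rcons (take i w') c ++ Bs.
  by rewrite cat_rcons -drop_nth // cat_take_drop.
have HB j : i < j -> j < size w' -> (des (drop j w')).*2 < size (drop j w').
  move=> lij ltj; have := B' (drop j w') (take j w').
  rewrite cat_take_drop -size_eq0 size_drop subn_eq0 -ltnNge ltj => /(_ erefl isT).
  rewrite leq_eqVlt => /orP[E|//].
  have := maxi j; rewrite /P ltj /= size_drop E; lia.
have nB : Bs != [::].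
  by apply: contra_eqN Pi => /eqP ->.
have ltB : i.+1 < size w' by move: nB; rewrite /Bs -size_eq0 size_drop subn_eq0 -ltnNge.
have HBs := HB i.+1 (ltnSn i) ltB; rewrite -/Bs in HBs.
move: Pi; rewrite -cat1s (@des_cat 0) //= (_ : des [:: c] = 0) // => Pi.
have dcB : head 0 Bs < c.
  by move: Pi HBs; case: (_ < _) => //=; clear; lia.
have tB : tight Bs by move: Pi; rewrite dcB /tight; clear; lia.
set A := rcons (take i w') c in EwB.
have nA : A != [::] by rewrite /A; case: (take i w').
have dAB : head 0 Bs < last 0 A by rewrite last_rcons.
have tA : tight A.
  by move: t'; rewrite EwB (@des_cat 0) // dAB size_cat; move: tB; rewrite /tight /=; lia.
have sub_w' : subseq w' w by rewrite Ew prefix_subseq.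
have [WA WB] : perm_word A /\ perm_word Bs.
  by apply: perm_word_cat; rewrite -EwB; move: W; rewrite Ew => /perm_word_cat[].
rewrite Ew size_cat EwB size_cat /= in Hn.
have Ew2 : w = A ++ Bs ++ [:: z] by rewrite catA -EwB.
rewrite Ew2; apply: sortable_cat_max; rewrite -?Ew2 -?EwB //.
  apply: IH => //; first by move: nB Hn; rewrite -size_eq0; clear; lia.
    move=> x y v s; apply: N; apply: subseq_trans s _; apply: subseq_trans sub_w'.
    by rewrite EwB prefix_subseq.
  (* A suffix [b] of [A] is bounded through the suffix [b ++ Bs] of [w'], where the descent at the
     junction and the tight [Bs] account for all but the required amount. *)
  move=> a b E nb; have := B' (b ++ Bs) a; rewrite EwB E catA => /(_ erefl).
  have Eb : last 0 b = last 0 A by rewrite E last_cat; case: (b) nb.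
  rewrite (@des_cat 0) // Eb dAB size_cat.
  move: tB; rewrite /tight; case: (b) nb => //= *; lia.
apply: IH => //; first by move: nA Hn; rewrite -size_eq0; clear; lia.
  move=> x y v s; apply: N; apply: subseq_trans s _; apply: subseq_trans sub_w'.
  by rewrite EwB suffix_subseq.
move=> a b E nb; have Eb : b = drop (i.+1 + size a) w'.
  by rewrite addnC -drop_drop -/Bs E drop_size_cat.
rewrite Eb; apply: HB; first lia.
by move: nb; rewrite Eb -size_eq0 size_drop subn_eq0 -ltnNge.
Qed.

(** * Permutations avoiding 132 or 312 *)

Definition no132 (w : seq nat) : Prop :=
  forall a c b, subseq [:: a; c; b] w -> a < b -> b < c -> False.

Lemma avoids132P w : avoids w [:: 1; 3; 2] <-> no132 w.
Proof.
split=> [A a c b s ab bc | N [u s [Es H]]].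
  apply: A; exists [:: a; c; b] => //; split=> // i j.
  by case: i => [|[|[|i]]] // _; case: j => [|[|[|j]]] //= _; lia.
case: u s Es H => [|a [|c [|b [|? ?]]]] // s _ H.
have /= ab := H 0 2 isT isT; have /= bc := H 2 1 isT isT.
exact: (N a c b s).
Qed.

Lemma avoids312P w : avoids w [:: 3; 1; 2] <-> no312 w.
Proof.
split=> [A c a b s ab bc | N [u s [Es H]]].
  apply: A; exists [:: c; a; b] => //; split=> // i j.
  by case: i => [|[|[|i]]] // _; case: j => [|[|[|j]]] //= _; lia.
case: u s Es H => [|c [|a [|b [|? ?]]]] // s _ H.
have /= ab := H 1 2 isT isT; have /= bc := H 2 0 isT isT.
exact: (N c a b s).
Qed.

Lemma subseq_cat_inv (T : eqType) (s u v : seq T) : subseq s (u ++ v) ->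
  exists s1 s2, [/\ s = s1 ++ s2, subseq s1 u & subseq s2 v].
Proof.
elim: u s => [|x u IH] [|y s] /=.
- by exists [::], [::].
- by exists [::], (y :: s).
- by exists [::], [::]; split=> //; rewrite sub0seq.
case: eqP => [->|ne] /IH [s1 [s2 [E h1 h2]]].
  by exists (x :: s1), s2; split=> //=; rewrite ?E ?eqxx.
exists s1, s2; split=> //; case: s1 E h1 => //= z s1 [<- _].
by move/eqP/negbTE: ne => ->.
Qed.

Lemma subseq3_cat (a b c : nat) u v : subseq [:: a; b; c] (u ++ v) ->
  [\/ subseq [:: a; b; c] u, subseq [:: a; b; c] v,
      subseq [:: a; b] u /\ c \in v | a \in u /\ subseq [:: b; c] v].
Proof.
case/subseq_cat_inv => s1 [s2 [E h1 h2]].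
case: s1 E h1 => [|x [|y [|z [|? ?]]]] //=; case: s2 h2 => [|x' [|y' [|z' [|? ?]]]] // h2 [].
- by move=> -> -> ->; constructor 2.
- by move=> -> -> -> h1; constructor 4; rewrite -sub1seq.
- by move=> -> -> -> h1; constructor 3; rewrite -sub1seq.
- by move=> -> -> -> h1; constructor 1.
Qed.

Lemma subseq2_mem (a b : nat) u : subseq [:: a; b] u -> a \in u /\ b \in u.
Proof.
by move=> /mem_subseq H; split; apply: H; rewrite !inE eqxx ?orbT.
Qed.

Lemma shape132_no132 T w : shape132 T w -> no132 w.
Proof.
elim: T w => [w -> ? ? ? //|X IX Y IY] w [x [y [z [-> Sx Sy Hx Hy]]]] a c b s ab bc.
have xy := ltn_allP Hx Hy.
case/subseq3_cat: s => [/(IX _ Sx)/(_ ab bc) // | | [/subseq2_mem[ax cx]] | [ax /subseq2_mem[]]].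
- case/subseq3_cat => [/(IY _ Sy)/(_ ab bc) // | | [/subseq2_mem[ax cx]] | [ax /subseq2_mem[]]].
  + by move/size_subseq.
  + by rewrite inE => /eqP Eb; move/(allP Hy): cx => /=; lia.
  + by rewrite !inE => /eqP E1 /eqP E2; move: bc; rewrite E1 E2; clear; lia.
- rewrite mem_cat inE => /orP[bY|/eqP Eb].
    by have := xy _ _ ax bY; lia.
  by move/(allP Hx): ax => /=; lia.
- rewrite !mem_cat !inE => _ /orP[bY|/eqP Eb].
    by have := xy _ _ ax bY; lia.
  by move/(allP Hx): ax => /=; lia.
Qed.

Lemma shape312_no312 T w : shape312 T w -> no312 w.
Proof.
elim: T w => [w -> ? ? ? //|X IX Y IY] w [x [y [z [-> Sx Sy Hx Hy]]]] c a b s ab bc.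
have xy := ltn_allP Hx Hy.
case/subseq3_cat: s => [/(IY _ Sy)/(_ ab bc) // | | [/subseq2_mem[cy ay]] | [cy /subseq2_mem[]]].
- case/subseq3_cat => [/(IX _ Sx)/(_ ab bc) // | | [/subseq2_mem[cx ax]] | [cx /subseq2_mem[]]].
  + by move/size_subseq.
  + by rewrite inE => /eqP Eb; move/(allP Hx): ax => /=; lia.
  + by rewrite !inE => /eqP E1 /eqP E2; move: ab; rewrite E1 E2; clear; lia.
- rewrite mem_cat inE => /orP[bX|/eqP Eb].
    by have := xy _ _ bX cy; lia.
  by move/(allP Hy): cy => /=; lia.
- rewrite !mem_cat !inE => _ /orP[bX|/eqP Eb].
    by have := xy _ _ bX cy; lia.
  by move/(allP Hy): cy => /=; lia.
Qed.

(** An entry below [z] followed by one above [z] would form the pattern 132 with the last letter. *)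
Lemma no132_filter_split z w : no132 (w ++ [:: z]) -> z \notin w ->
  w = filter (ltn z) w ++ filter (gtn z) w.
Proof.
elim: w => // v w IH N; rewrite inE negb_or => /andP[nv nw] /=.
have N' : no132 (w ++ [:: z]).
  by move=> a c b s; apply: N; apply: subseq_trans s _; apply: subseq_cons.
have [lt|ge] := ltnP z v.
  have -> : v < z = false by lia.
  by rewrite /= -(IH N' nw).
have lt : v < z by rewrite ltn_neqAle eq_sym nv.
rewrite lt; have E : filter (ltn z) w = [::].
  apply/eqP; rewrite -(negbK (_ == _)) -has_filter; apply/hasPn => c Hc /=.
  apply/negP => zc; apply: (N v c z) => //=.
  by rewrite eqxx -[[:: c; z]]/([:: c] ++ [:: z]); apply: cat_subseq; rewrite sub1seq ?mem_head.
by rewrite {1}(IH N' nw) E.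
Qed.

Lemma shape132_exists w : uniq w -> no132 w -> exists T, shape132 T w.
Proof.
have [n] := ubnP (size w); elim: n w => // n IH w.
case/lastP: w => [|w z] Hn U N; first by exists NoTree.
move: Hn U; rewrite size_rcons rcons_uniq => Hn /andP[nz U]; rewrite -cats1 in N *.
have E := no132_filter_split N nz.
have sub p : no132 (filter p w).
  move=> a c b s; apply: N; apply: subseq_trans s _.
  exact: subseq_trans (filter_subseq _ _) (prefix_subseq _ _).
have lts p : size (filter p w) < n.
  by rewrite size_filter; move: Hn (count_size p w); clear; lia.
have [X SX] := IH _ (lts (ltn z)) (filter_uniq _ U) (sub _).
have [Y SY] := IH _ (lts (gtn z)) (filter_uniq _ U) (sub _).
exists (Snoc X Y), (filter (ltn z) w), (filter (gtn z) w), z.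
by rewrite catA -E; split=> //; apply: filter_all.
Qed.

Lemma perm_iota_cat a b o n : perm_eq (a ++ b) (iota o n) -> {in a & b, forall x y, x < y} ->
  perm_eq a (iota o (size a)) /\ perm_eq b (iota (o + size a) (size b)).
Proof.
move=> P lt.
have En : n = size a + size b by rewrite -size_cat (perm_size P) size_iota.
have E : sort leq a ++ sort leq b = iota o n.
  apply: (sorted_eq leq_trans anti_leq); last by rewrite -(permPr P) perm_cat // perm_sort.
    rewrite (sorted_pairwise leq_trans) pairwise_cat -!(sorted_pairwise leq_trans).
    rewrite !sort_sorted ?andbT; try exact: leq_total.
    by apply/allrelP => x y; rewrite !mem_sort => xa yb; apply: ltnW; apply: lt.
  exact: iota_sorted.
move/eqP: E; rewrite En iotaD eqseq_cat ?size_sort ?size_iota // => /andP[/eqP Ea /eqP Eb].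
by rewrite -Ea -Eb !(perm_sym _ (sort _ _)) !perm_sort.
Qed.

(** The offset [o] is there for the recursion: the blocks of a permutation carry intervals of values
    that need not start at 1. *)
Lemma perm_iota3 x y z o n : perm_eq (x ++ y ++ [:: z]) (iota o n) ->
    all (ltn z) x -> all (gtn z) y ->
  [/\ perm_eq y (iota o (size y)), z = o + size y & perm_eq x (iota (o + size y).+1 (size x))].
Proof.
move=> P Hx Hy; have P1 : perm_eq (y ++ [:: z] ++ x) (iota o n).
  by apply: perm_trans P; rewrite catA perm_catC.
have [|Py P2] := perm_iota_cat P1.
  move=> a b aY; rewrite mem_cat inE => /orP[/eqP->|bX]; first exact: (allP Hy).
  exact: (ltn_allP Hx Hy).
rewrite size_cat in P2; have [|Pz Px] := perm_iota_cat P2.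
  by move=> a b; rewrite inE => /eqP ->; apply: (allP Hx).
split=> //; last by move: Px; rewrite /= addn1.
by have /perm_mem/(_ z) := Pz; rewrite !inE eqxx => /esym /eqP.
Qed.

Lemma shape132_unique T w w' o n n' : shape132 T w -> shape132 T w' ->
  perm_eq w (iota o n) -> perm_eq w' (iota o n') -> w = w'.
Proof.
elim: T w w' o n n' => [|X IX Y IY] w w' o n n'; first by move=> -> ->.
move=> [x [y [z [-> Sx Sy Hx Hy]]]] [x' [y' [z' [-> Sx' Sy' Hx' Hy']]]] P P'.
have [Py Ez Px] := perm_iota3 P Hx Hy; have [Py' Ez' Px'] := perm_iota3 P' Hx' Hy'.
have Ey := IY _ _ _ _ _ Sy Sy' Py Py'; subst y'.
by rewrite (IX _ _ _ _ _ Sx Sx' Px Px') Ez Ez'.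
Qed.

Lemma shape132_construct T o : exists w, shape132 T w /\ perm_eq w (iota o (fsize T)).
Proof.
elim: T o => [|X IX Y IY] o; first by exists [::].
have [y [Sy Py]] := IY o; have [x [Sx Px]] := IX (o + fsize Y).+1.
exists (x ++ y ++ [:: o + fsize Y]); split.
  exists x, y, (o + fsize Y); split=> //; apply/allP => v.
    by rewrite (perm_mem Px) mem_iota /= => /andP[].
  by rewrite (perm_mem Py) mem_iota /= => /andP[].
have -> : fsize (Snoc X Y) = fsize Y + (1 + fsize X) by move=> /=; lia.
by rewrite !iotaD /= perm_catC -catA perm_cat //= perm_cons addn1.
Qed.

(** * The sliding operator *)

(* The decreasing binary tree of w; its nodes labelled [i] or more have all left labels above the right
   ones, which is what [swu i] achieves at the node labelled [i]. *)
Fixpoint dtree (i : nat) (T : forest) (w : seq nat) : Prop :=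
  if T is Snoc X Y then
    exists x y z, [/\ w = x ++ z :: y, dtree i X x, dtree i Y y,
      all (gtn z) x && all (gtn z) y & i <= z -> {in x & y, forall a b, b < a}]
  else w = [::].

(** The two thresholds may differ, provided that a node subject to the order condition after the
    relabelling was already subject to it before. *)
Lemma dtree_map f i j T w : {in w &, {homo f : a b / a < b}} ->
  (forall z, z \in w -> i <= f z -> j <= z) -> dtree j T w -> dtree i T (map f w).
Proof.
elim: T w => [|X IX Y IY] w; first by move=> _ _ ->.
move=> M H [x [y [z [E Dx Dy /andP[Hx Hy] C]]]]; subst w.
have sx : {subset x <= x ++ z :: y} by move=> v; rewrite mem_cat => ->.
have sy : {subset y <= x ++ z :: y} by move=> v; rewrite mem_cat inE => ->; rewrite !orbT.
have zz : z \in x ++ z :: y by rewrite mem_cat mem_head orbT.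
exists (map f x), (map f y), (f z); split.
- by rewrite map_cat.
- by apply: IX Dx => [a b /sx ha /sx hb|v /sx]; [apply: M | apply: H].
- by apply: IY Dy => [a b /sy ha /sy hb|v /sy]; [apply: M | apply: H].
- by rewrite !all_map; apply/andP; split; apply/allP => v hv /=;
    apply: M => //; [apply: sx | apply: (allP Hx) | apply: sy | apply: (allP Hy)].
- move=> /(H _ zz)/C {}C _ _ /mapP[a ha ->] /mapP[b hb ->].
  by apply: M; [apply: sy | apply: sx | apply: C].
Qed.

Lemma dtree_weaken i j T w : j <= i -> dtree j T w -> dtree i T w.
Proof.
move=> le D; rewrite -(map_id w); apply: dtree_map D => // z _.
exact: leq_trans.
Qed.

Lemma shape312_shift d T w : shape312 T w -> shape312 T (map (addn d) w).
Proof.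
elim: T w => [|X IX Y IY] w; first by move=> ->.
move=> [x [y [z [-> Sx Sy Hx Hy]]]].
exists (map (addn d) x), (map (addn d) y), (d + z); split.
- by rewrite !map_cat.
- exact: IX.
- exact: IY.
- by rewrite all_map; apply: sub_all Hx => v /=; rewrite ltn_add2l.
- by rewrite all_map; apply: sub_all Hy => v /=; rewrite ltn_add2l.
Qed.

(** [perm_inv] for words on the values from [o] on, so that it applies to blocks. *)
Definition inv_from (o : nat) (w : seq nat) : seq nat :=
  [seq (index v w).+1 | v <- iota o (size w)].

Lemma inv_from_le o w : perm_eq w (iota o (size w)) -> all (geq (size w)) (inv_from o w).
Proof.
move=> P; apply/allP => _ /mapP[v hv ->] /=.
by rewrite index_mem (perm_mem P).
Qed.

Lemma inv_from_shape132 o x y z : all (ltn z) x -> all (gtn z) y ->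
    perm_eq (x ++ y ++ [:: z]) (iota o (size (x ++ y ++ [:: z]))) ->
  inv_from o (x ++ y ++ [:: z]) =
    map (addn (size x)) (inv_from o y) ++ (size x + size y).+1 :: inv_from z.+1 x.
Proof.
move=> Hx Hy P; have [Py Ez Px] := perm_iota3 P Hx Hy.
have xz v : v \in x -> z < v by move/(allP Hx).
have yz v : v \in y -> v < z by move/(allP Hy).
rewrite /inv_from; have -> : size (x ++ y ++ [:: z]) = size y + (1 + size x).
  by rewrite !size_cat /=; lia.
rewrite !iotaD !map_cat -map_comp -Ez /=; congr (_ ++ _ :: _).
- apply/eq_in_map => v hv; have vy : v \in y by rewrite (perm_mem Py).
  rewrite /= index_cat ifN; last by apply/negP => /xz; have := yz v vy; lia.
  by rewrite index_cat vy addnS.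
- rewrite index_cat ifN; last by apply/negP => /xz; lia.
  rewrite index_cat ifN; last by apply/negP => /yz; lia.
  by rewrite /= eqxx addn0.
- rewrite addn1; apply/eq_in_map => v hv.
  by rewrite index_cat (perm_mem Px) -Ez hv.
Qed.

(** The inverse lists the positions of the letters of [y], then that of [z], which is the largest,
    then those of [x]; reversed, this is a root with [X] on its left and [Y] on its right. With [i]
    above all labels the order condition is vacuous. *)
Lemma shape132_dtree T w o i : shape132 T w -> perm_eq w (iota o (size w)) -> size w < i ->
  dtree i T (rev (inv_from o w)).
Proof.
elim: T w o i => [|X IX Y IY] w o i; first by move=> ->.
move=> [x [y [z [-> Sx Sy Hx Hy]]]] P lt; rewrite inv_from_shape132 //.
have [Py Ez Px] := perm_iota3 P Hx Hy; rewrite -Ez in Px.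
move: lt; rewrite !size_cat /= => lt.
exists (rev (inv_from z.+1 x)), (map (addn (size x)) (rev (inv_from o y))), (size x + size y).+1.
split.
- by rewrite rev_cat rev_cons map_rev cat_rcons.
- by apply: IX => //; move: lt; clear; lia.
- apply: (@dtree_weaken _ (size x + (size y).+1)); first by move: lt; clear; lia.
  apply: dtree_map (IY y o (size y).+1 Sy Py (ltnSn _)) => [a b _ _|v _].
    by rewrite ltn_add2l.
  by rewrite leq_add2l.
- rewrite all_map !all_rev; apply/andP; split.
    by apply: sub_all (inv_from_le Px) => v /=; lia.
  by apply: sub_all (inv_from_le Py) => v /=; lia.
- by move: lt; clear; lia.
Qed.

(** The order condition holds at every node, so the labels of [y] lie below those of [x], and
    undoing the rotation puts the block of [y] first. *)
Lemma dtree_shape312 T w o : dtree o T w -> perm_eq w (iota o (size w)) ->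
  shape312 T (inv_from o (rev w)).
Proof.
elim: T w o => [|X IX Y IY] w o; first by move=> ->.
move=> [x [y [z [-> Dx Dy /andP[Hx Hy] C]]]] P.
have oz : o <= z.
  have : z \in x ++ z :: y by rewrite mem_cat mem_head orbT.
  by rewrite (perm_mem P) mem_iota => /andP[].
have {}C := C oz.
have P1 : perm_eq (y ++ x ++ [:: z]) (iota o (size (x ++ z :: y))).
  by apply: perm_trans P; rewrite perm_catC -catA perm_cat.
have [|Py P2] := perm_iota_cat P1.
  move=> b a bY; rewrite mem_cat inE => /orP[aX|/eqP->]; first exact: C.
  exact: (allP Hy).
rewrite size_cat in P2; have [|Px Pz] := perm_iota_cat P2.
  by move=> a b aX; rewrite inE => /eqP ->; apply: (allP Hx).
have Ez : z = o + size y + size x.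
  by have /perm_mem/(_ z) := Pz; rewrite !inE eqxx => /esym /eqP.
have Dy' := dtree_weaken _ Dy.
have Dx' : dtree (o + size y) X x by apply: dtree_weaken Dx; apply: leq_addr.
exists (map (addn (size y).+1) (inv_from (o + size y) (rev x))), (inv_from o (rev y)), (size y).+1.
have Py' : perm_eq (rev y) (iota o (size (rev y))) by rewrite size_rev perm_rev.
have Px' : perm_eq (rev x) (iota (o + size y) (size (rev x))) by rewrite size_rev perm_rev.
split.
- rewrite /inv_from rev_cat rev_cons cat_rcons !size_rev.
  have -> : size (rev y ++ z :: rev x) = size y + (size x + 1).
    by rewrite size_cat /= !size_rev; lia.
  rewrite !iotaD !map_cat -map_comp -Ez /=; congr (_ ++ (_ ++ [:: _])).
  + apply/eq_in_map => v; rewrite -(perm_mem Py) => vy.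
    by rewrite index_cat mem_rev vy.
  + apply/eq_in_map => v; rewrite -(perm_mem Px) => vx.
    rewrite index_cat mem_rev ifN; last by apply/negP => /(C _ _ vx); rewrite ltnn.
    rewrite /= ifN ?size_rev ?addSn ?addnS //.
    by apply/eqP => zv; have := allP Hx _ vx; rewrite /= zv ltnn.
  + rewrite index_cat mem_rev ifN; last by apply/negP => /(allP Hy) /=; rewrite ltnn.
    by rewrite /= eqxx size_rev addn0.
- by apply: shape312_shift; apply: IX.
- exact: IY.
- by rewrite all_map; apply/allP => v /mapP[u _ ->] /=; lia.
- by apply: sub_all (inv_from_le Py') => v /=; rewrite size_rev.
Qed.

(** What is needed of the relabelling [f] done by [swu i] on [l ++ i :: r], freed from the counting
    formula. *)
Definition slide (i : nat) (l r : seq nat) (f : nat -> nat) : Prop :=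
  [/\ forall v, i <= v -> f v = v,
      forall v, v \in l ++ r -> v < i -> 0 < f v < i,
      {in l &, {homo f : a b / a < b}},
      {in r &, {homo f : a b / a < b}} &
      forall a b, a \in l -> b \in r -> a < i -> b < i -> f b < f a].

Lemma slide_sub i l r l' r' f : {subset l' <= l} -> {subset r' <= r} ->
  slide i l r f -> slide i l' r' f.
Proof.
move=> sl sr [H1 H2 H3 H4 H5]; split=> //.
- by move=> v hv; apply: H2; move: hv; rewrite !mem_cat => /orP[/sl|/sr] ->; rewrite ?orbT.
- by move=> a b /sl ha /sl hb; apply: H3.
- by move=> a b /sr ha /sr hb; apply: H4.
- by move=> a b /sl ha /sr hb; apply: H5.
Qed.

Lemma slide_gt i l r f a b : slide i l r f -> a \in l -> b \in r -> b < a -> f b < f a.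
Proof.
move=> [H1 H2 H3 H4 H5] al br ba.
have [ib|bi] := leqP i b; first by rewrite !H1 //; lia.
have bb : b \in l ++ r by rewrite mem_cat br orbT.
have /andP[_ fb] := H2 b bb bi.
have [ia|ai] := leqP i a; last exact: H5.
by rewrite (H1 a) //; apply: leq_trans ia.
Qed.

Lemma slide_lt i l r f z v : slide i l r f -> v \in l ++ i :: r -> i < z -> v < z -> f v < z.
Proof.
move=> [H1 H2 _ _ _] hv iz vz; have [iv|vi] := leqP i v; first by rewrite H1.
move: hv; rewrite mem_cat inE => hv; have /andP[_ h] : 0 < f v < i.
  apply: H2 => //; rewrite mem_cat; case/or3P: hv => [->//|/eqP E|->]; last by rewrite orbT.
  by move: vi; rewrite E ltnn.
by move: h iz; clear; lia.
Qed.

(** The induction descends to the node [i]. There the last clause of [slide] creates the order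
    condition; at the ancestors of [i] it survives, because [f] is increasing on each side of [i]
    and preserves every left entry above a right one. *)
Lemma dtree_slide i T l r f : slide i l r f -> i \notin l -> i \notin r ->
  dtree i.+1 T (l ++ i :: r) -> dtree i T (map f (l ++ i :: r)).
Proof.
elim: T l r => [|X IX Y IY] l r S nl nr; first by case: l S nl.
move=> [x [y [z [E Dx Dy /andP[Hx Hy] C]]]].
have [H1 H2 H3 H4 H5] := S.
(* A subtree without [i] that lies on one side of [i]: no entry of it is sent to [i], so the
   threshold can drop from [i.+1] to [i]. *)
have mono T' u : dtree i.+1 T' u -> {in u &, {homo f : a b / a < b}} -> {subset u <= l ++ r} ->
    dtree i T' (map f u).
  move=> Du Mu su; apply: dtree_map Du => // v hv iv.
  rewrite ltn_neqAle; apply/andP; split.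
    apply/eqP => Ev; have := su _ hv; rewrite -Ev mem_cat (negbTE nl) (negbTE nr) //.
  rewrite leqNgt; apply/negP => vi; have := H2 v (su _ hv) vi; move: iv; clear; lia.
have lt3 : [\/ size x < size l, size x = size l | size l < size x].
  by case: (ltngtP (size x) (size l)) => h; [constructor 1|constructor 3|constructor 2].
case: lt3 => h.
(* The node [i] lies in the right subtree; the next two cases are [i] at the root and [i] in the
   left subtree. *)
- have [e [El Ee]] := cat_split (esym E) (ltnW h).
  case: e El Ee => [El|z' l1 El [Ez Ey]]; first by move: h; rewrite El cats0 ltnn.
  subst z' l; have iy : i \in y by rewrite Ey mem_cat mem_head orbT.
  have iz : i < z by apply: (allP Hy).
  have sx : {subset x <= x ++ z :: l1} by move=> v; rewrite mem_cat => ->.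
  have sl : {subset l1 <= x ++ z :: l1} by move=> v; rewrite mem_cat inE => ->; rewrite !orbT.
  have fz : f z = z by apply: H1; apply: ltnW.
  have nl1 : i \notin l1 by apply: contra nl; apply: sl.
  exists (map f x), (map f y), (f z); split.
  + by rewrite Ey -catA map_cat.
  + apply: mono => // [a b /sx ha /sx hb|v /sx]; [exact: H3|by move=> hv; rewrite mem_cat hv].
  + rewrite Ey; apply: IY; rewrite -?Ey //.
    exact: slide_sub S.
  + rewrite fz !all_map; apply/andP; split; apply/allP => v hv /=.
      by apply: (slide_lt S) => //; [rewrite mem_cat sx | apply: (allP Hx)].
    apply: (slide_lt S) => //; last exact: (allP Hy).
    by move: hv; rewrite Ey !mem_cat !inE => /orP[->|->]; rewrite ?orbT.
  + move=> _ _ _ /mapP[a ha ->] /mapP[b hb ->]; have ba := C iz _ _ ha hb.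
    move: hb; rewrite Ey mem_cat inE => /or3P[hb|/eqP Eb|hb].
    * by apply: H3 => //; [apply: sl | apply: sx].
    * by move: ba; rewrite Eb => ia; rewrite !H1 // ltnW.
    * by apply: (slide_gt S) => //; apply: sx.
- move/eqP: E; rewrite eqseq_cat ?h // => /andP[/eqP El /eqP[Ei Er]]; subst x y z.
  have fi : f i = i by apply: H1.
  exists (map f l), (map f r), (f i); split.
  + by rewrite map_cat.
  + by apply: mono => // v; rewrite mem_cat => ->.
  + by apply: mono => // v; rewrite mem_cat => ->; rewrite orbT.
  + rewrite fi !all_map; apply/andP; split; apply/allP => v hv /=.
      by have := H2 v; rewrite mem_cat hv => /(_ isT (allP Hx v hv)) /andP[].
    by have := H2 v; rewrite mem_cat hv orbT => /(_ isT (allP Hy v hv)) /andP[].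
  + move=> _ _ _ /mapP[a ha ->] /mapP[b hb ->].
    by apply: H5 => //; [apply: (allP Hx) | apply: (allP Hy)].
- have [e [Ex Ee]] := cat_split E (ltnW h).
  case: e Ex Ee => [Ex|i' r1 Ex [Ei Er]]; first by move: h; rewrite Ex cats0 ltnn.
  subst i' x r; have ix : i \in l ++ i :: r1 by rewrite mem_cat mem_head orbT.
  have iz : i < z by apply: (allP Hx).
  have sy : {subset y <= r1 ++ z :: y} by move=> v; rewrite mem_cat inE => ->; rewrite !orbT.
  have sr : {subset r1 <= r1 ++ z :: y} by move=> v; rewrite mem_cat => ->.
  have fz : f z = z by apply: H1; apply: ltnW.
  exists (map f (l ++ i :: r1)), (map f y), (f z); split.
  + by rewrite -map_cons -map_cat -catA.
  + by apply: IX => //; [apply: slide_sub S | apply: contra nr; apply: sr].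
  + apply: mono => // [a b /sy ha /sy hb|v /sy]; [exact: H4|by move=> hv; rewrite mem_cat hv orbT].
  + rewrite fz !all_map; apply/andP; split; apply/allP => v hv /=.
      apply: (slide_lt S) => //; last exact: (allP Hx).
      by move: hv; rewrite !mem_cat !inE mem_cat => /or3P[->|->|->]; rewrite ?orbT.
    apply: (slide_lt S) => //; last exact: (allP Hy).
    by rewrite mem_cat inE sy ?orbT.
  + move=> _ _ _ /mapP[a ha ->] /mapP[b hb ->]; have ba := C iz _ _ ha hb.
    move: ha; rewrite mem_cat inE => /or3P[ha|/eqP Ea|ha].
    * by apply: (slide_gt S) => //; apply: sy.
    * move: ba; rewrite Ea => bi; rewrite (H1 i) //.
      by have := H2 b; rewrite mem_cat sy // orbT => /(_ isT bi) /andP[].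
    * by apply: H4 => //; [apply: sy | apply: sr].
Qed.

Lemma count_lt (T : Type) (p q : pred T) (s : seq T) : subpred p q -> has (predD q p) s ->
  count p s < count q s.
Proof.
move=> pq; elim: s => //= x s IH /orP[/andP[npx qx]|/IH h].
  by rewrite qx (negbTE npx) add1n add0n ltnS; apply: sub_count.
apply: leq_trans (_ : p x + (count q s) <= _); first by rewrite -addnS leq_add2l.
by rewrite leq_add2r; case px : (p x) => //; rewrite (pq _ px).
Qed.

Lemma count_lt_iota i n : 0 < i <= n -> count (gtn i) (iota 1 n) = i.-1.
Proof.
move=> Hi; have -> : n = i.-1 + (n - i.-1) by lia.
rewrite iotaD count_cat (_ : count _ (iota 1 _) = i.-1); last first.
  by apply/eqP; rewrite -[X in _ == X](size_iota 1) -all_count; apply/allP => v; rewrite mem_iota /=; lia.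
rewrite (_ : count _ _ = 0) ?addn0 //; apply/eqP; rewrite -leqn0 leqNgt -has_count.
by apply/hasPn => v; rewrite mem_iota /=; lia.
Qed.

Lemma swu_slide n i w : Sn n w -> 0 < i <= n ->
  exists l r f, [/\ w = l ++ i :: r, i \notin l, i \notin r, swu i w = map f w & slide i l r f].
Proof.
move=> Pw Hi; have iw : i \in w by rewrite (Sn_mem Pw).
have U := Sn_uniq Pw.
have [l [r Ew]] : exists l r, w = l ++ i :: r by case/splitPr: iw => l r; exists l, r.
move: U; rewrite Ew cat_uniq /= negb_or => /and3P[_ /andP[nl disj] /andP[nr _]].
have Ei : index i w = size l by rewrite Ew index_cat (negbTE nl) /= eqxx addn0.
have EL : Lset i w = filter (gtn i) l by rewrite /Lset Ei Ew take_size_cat.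
have ER : Rset i w = filter (gtn i) r.
  by rewrite /Rset Ei Ew -cat_rcons drop_size_cat ?size_rcons.
pose f x := if i <= x then x
       else if x \in Rset i w then count (fun y => y <= x) (Rset i w)
       else i - count (fun y => x <= y) (Lset i w).
exists l, r, f; split=> //; first by rewrite -Ew.
move: (Lset i w) (Rset i w) @f EL ER => L R f EL ER.
(* The new values of [R] are 1, ..., |R| and those of [L] are [i] - |L|, ..., [i] - 1; this count
   makes the two ranges adjacent. *)
have sLR : (size L + size R).+1 = i.
  have /(_ (gtn i)) := permP Pw; rewrite count_lt_iota // Ew count_cat /= ltnn add0n.
  by rewrite EL ER !size_filter /= => ->; case: (i) Hi.
have inL v : v \in l -> v < i -> v \in L by move=> h1 h2; rewrite EL mem_filter /= h2.
have inR v : v \in r -> v < i -> v \in R by move=> h1 h2; rewrite ER mem_filter /= h2.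
have notR v : v \in l -> v \notin R.
  move=> vl; rewrite ER mem_filter negb_and; apply/orP; right.
  by apply: contra disj => vr; apply/hasP; exists v.
have fR v : v \in r -> v < i -> f v = count (fun y => y <= v) R.
  by move=> vr vi; rewrite /f leqNgt vi /= inR.
have fL v : v \in l -> v < i -> f v = i - count (fun y => v <= y) L.
  by move=> vl vi; rewrite /f leqNgt vi /= (negbTE (notR v vl)).
have H2 v : v \in l ++ r -> v < i -> 0 < f v < i.
  rewrite mem_cat => /orP[vl|vr] vi.
    rewrite fL //; have : 0 < count (fun y => v <= y) L.
      by rewrite -has_count; apply/hasP; exists v; rewrite ?inL.
    by move: (count_size (fun y => v <= y) L) sLR; move: (count _ L); clear; lia.
  rewrite fR //; have : 0 < count (fun y => y <= v) R.
    by rewrite -has_count; apply/hasP; exists v; rewrite ?inR.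
  by move: (count_size (fun y => y <= v) R) sLR; move: (count _ R); clear; lia.
have f1 v : i <= v -> f v = v by rewrite /f => ->.
split=> //.
- move=> a b al bl ab; have [ib|bi] := leqP i b.
    rewrite (f1 b) //; have [ia|ai] := leqP i a; first by rewrite f1.
    have /andP[_ h] : 0 < f a < i by apply: H2; rewrite ?mem_cat ?al.
    exact: leq_trans h ib.
  have ai := ltn_trans ab bi; rewrite !fL //.
  have : count (fun y => b <= y) L < count (fun y => a <= y) L.
    apply: count_lt => [v /= bv|]; first exact: leq_trans (ltnW ab) bv.
    by apply/hasP; exists a; rewrite ?inL //= leqnn -ltnNge ab.
  move: (count_size (fun y => a <= y) L) sLR.
  by move: (count _ L) => c1; move: (count _ L); clear; lia.
- move=> a b ar br ab; have [ib|bi] := leqP i b.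
    rewrite (f1 b) //; have [ia|ai] := leqP i a; first by rewrite f1.
    have /andP[_ h] : 0 < f a < i by apply: H2; rewrite ?mem_cat ?ar ?orbT.
    exact: leq_trans h ib.
  have ai := ltn_trans ab bi; rewrite !fR //.
  apply: count_lt => [v /= va|]; first exact: leq_trans va (ltnW ab).
  by apply/hasP; exists b; rewrite ?inR //= leqnn -ltnNge ab.
- move=> a b al br ai bi; rewrite (fL a) // (fR b) //.
  move: (count_size (fun y => a <= y) L) (count_size (fun y => y <= b) R) sLR.
  by move: (count _ L) => c1; move: (count _ R); clear; lia.
Qed.

Lemma swu_Sn n i w : Sn n w -> 0 < i <= n -> Sn n (swu i w).
Proof.
move=> Pw Hi; have [l [r [f [Ew nl nr -> S]]]] := swu_slide Pw Hi.
have [H1 H2 H3 H4 H5] := S; have U := Sn_uniq Pw.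
have fi : f i = i by apply: H1.
have lr v : v \in w -> v < i -> v \in l ++ r.
  rewrite Ew !mem_cat inE => /or3P[->//|/eqP->|->]; rewrite ?ltnn ?orbT //.
have fw v : v \in w -> v < i -> 0 < f v < i by move=> vw vi; apply: H2 => //; apply: lr.
have inj a b : a \in w -> b \in w -> a < b -> f a != f b.
  move=> aw bw ab; have [ib|bi] := leqP i b.
    rewrite (H1 b) //; have [ia|ai] := leqP i a; first by rewrite H1 // ltn_eqF.
    by have := fw a aw ai; move: ib; clear; lia.
  have ai := ltn_trans ab bi.
  have := lr _ aw ai; have := lr _ bw bi; rewrite !mem_cat => /orP[bl|br] /orP[al|ar].
  - by rewrite ltn_eqF // H3.
  - by rewrite ltn_eqF // H5.
  - by rewrite gtn_eqF // H5.
  - by rewrite ltn_eqF // H4.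
have Uf : uniq (map f w).
  rewrite map_inj_in_uniq // => a b aw bw E; have [lt|gt|//] := ltngtP a b.
    by have := inj a b aw bw lt; rewrite E eqxx.
  by have := inj b a bw aw gt; rewrite E eqxx.
apply: uniq_perm => //; first exact: iota_uniq.
have sub : {subset map f w <= iota 1 n}.
  move=> _ /mapP[v vw ->]; rewrite mem_iota add1n ltnS.
  have [iv|vi] := leqP i v; first by rewrite H1 // -(Sn_mem Pw).
  by have := fw v vw vi; move: Hi; clear; lia.
have [|//] := uniq_min_size Uf sub.
by rewrite size_map size_iota (Sn_size Pw).
Qed.

Lemma swu_dtree n i T w : Sn n w -> 0 < i <= n -> dtree i.+1 T w -> dtree i T (swu i w).
Proof.
move=> Pw Hi; have [l [r [f [Ew nl nr -> S]]]] := swu_slide Pw Hi.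
by rewrite Ew; apply: dtree_slide.
Qed.

Lemma inv_from1 n w : Sn n w -> perm_eq w (iota 1 (size w)).
Proof.
by move=> Pw; rewrite (Sn_size Pw).
Qed.

(** As [swl_n] acts first, the threshold falls from [n.+1], where nothing is required, down to 1;
    the rotations between consecutive factors cancel. *)
Lemma swl_dtree n T p : Sn n p -> shape132 T p -> Sn n (swl p) /\ dtree 1 T (rot_perm (swl p)).
Proof.
move=> Pp S.
have key m i : i + m = n.+1 -> 0 < i -> Sn n (foldr swl_at p (iota i m)) /\
    dtree i T (rot_perm (foldr swl_at p (iota i m))).
  elim: m i => [|m IH] i /= E i0.
    split=> //; apply: shape132_dtree => //; first exact: inv_from1 Pp.
    by rewrite (Sn_size Pp) -E addn0.
  have [||P1 D1] := IH i.+1; rewrite ?addSnnS //.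
  have Hi : 0 < i <= n by move: E i0; clear; lia.
  have P2 := swu_Sn (rot_perm_Sn P1) Hi.
  rewrite /swl_at (rot_perm_invK P2); split; first exact: rot_perm_inv_Sn.
  exact: swu_dtree (rot_perm_Sn P1) Hi D1.
by rewrite /swl (Sn_size Pp); apply: key.
Qed.

Lemma swl_shape312 n T p : Sn n p -> shape132 T p -> shape312 T (swl p).
Proof.
move=> Pp S; have [Ps D] := swl_dtree Pp S.
by rewrite -(rot_permK Ps); apply: dtree_shape312 => //; apply: inv_from1 (rot_perm_Sn Ps).
Qed.

(** * Descent words and preorder codes *)

(** The number of trees of [T], hence the arity of a node whose children form [T]. *)
Fixpoint ar (T : forest) : nat := if T is Snoc X _ then (ar X).+1 else 0.

(* Arities of the nodes in preorder. *)
Fixpoint code (T : forest) : seq nat := if T is Snoc X Y then code X ++ ar Y :: code Y else [::].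

Definition blocks (g : seq nat) : seq step := flatten [seq U :: nseq x D | x <- g].
(** [gam] gives the exponents of the first path; [canopy] gives the second path followed by one more
    [D], because the last node in preorder is a leaf. *)
Definition gam (c : seq nat) : seq nat := [seq m.-1 | m <- c & 0 < m].
Definition canopy (c : seq nat) : seq step := [seq if 0 < m then U else D | m <- c].
Definition flip (a : step) : step := if a is U then D else U.

Lemma gam_cat a b : gam (a ++ b) = gam a ++ gam b.
Proof.
by rewrite /gam filter_cat map_cat.
Qed.

Lemma blocks_cat a b : blocks (a ++ b) = blocks a ++ blocks b.
Proof.
by rewrite /blocks map_cat flatten_cat.
Qed.

Lemma gam_cons m c : gam (m :: c) = (if 0 < m then [:: m.-1] else [::]) ++ gam c.
Proof.
by rewrite /gam /=; case: ifP.
Qed.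

Lemma ar_gt0 T : (0 < ar T) = ~~ is_empty T.
Proof.
by case: T.
Qed.

Lemma dsteps_rcons a z : a != [::] ->
  dsteps (a ++ [:: z]) = dsteps a ++ [:: cmp (last 0 a) z].
Proof.
by case: a => // x s _; rewrite dsteps_cat.
Qed.

(** The word ends with the roots in decreasing order, whence the leading letters [D]. An internal
    node yields the ascent after the block [y], which itself ends with the roots of [Y]: read
    backwards, a [U] followed by [(ar Y).-1] letters [D]. *)
Lemma shape312_dsteps T w : shape312 T w -> ~~ is_empty T ->
  rev (dsteps w) = nseq (ar T).-1 D ++ blocks (gam (code T)).
Proof.
elim: T w => // X IX Y IY w [x [y [z [-> Sx Sy Hx Hy]]]] _ /=.
rewrite gam_cat gam_cons ar_gt0 !blocks_cat -(shape312_empty Sy).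
have {}IX := IX _ Sx; have {}IY := IY _ Sy.
rewrite -(shape312_empty Sx) in IX; rewrite -(shape312_empty Sy) in IY.
have EX : x == [::] -> X = NoTree by rewrite (shape312_empty Sx); case: (X).
have EY : y == [::] -> Y = NoTree by rewrite (shape312_empty Sy); case: (Y).
have [Ex|nx] := eqVneq x [::].
  rewrite EX ?Ex //=; have [Ey|ny] := eqVneq y [::]; first by rewrite EY ?Ey.
  rewrite dsteps_rcons // rev_cat IY // /cmp.
  have -> : z < last 0 y = false by have := allP Hy _ (last_mem ny) => /=; move: (last _ _); clear; lia.
  by rewrite /= cats0.
have EaX : ar X = (ar X).-1.+1 by rewrite prednK // ar_gt0 -(shape312_empty Sx).
have ltx : z < last 0 x by apply: (allP Hx); apply: last_mem.
have {}IX := IX nx.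
have [Ey|ny] := eqVneq y [::].
  rewrite EY ?Ey //= dsteps_rcons // rev_cat IX // /cmp ltx /= !cats0.
  by rewrite {2}EaX.
have {}IY := IY ny.
have -> : dsteps (y ++ x ++ [:: z]) = dsteps y ++ U :: dsteps x ++ [:: D].
  have -> : dsteps x ++ [:: D] = dsteps (x ++ [:: z]) by rewrite dsteps_rcons // /cmp ltx.
  case: (x) (y) nx ny (ltn_allP Hx Hy) => // x0 x1 [|y0 y1] // _ _ yx.
  rewrite (@dsteps_cat y0 y1 x0 (x1 ++ [:: z])) /cmp.
  have := yx x0 (last y0 y1); rewrite mem_head mem_last => /(_ isT isT) lt.
  by have -> : x0 < last y0 y1 = false by move: lt; clear; lia.
rewrite rev_cat rev_cons rev_cat IX IY /= {2}EaX /=.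
by rewrite cat_rcons -!catA.
Qed.

(** Inorder in the binary tree is preorder in the forest. A node is followed by a descent exactly
    when its right subtree, the forest of its children, is nonempty; the last node is a leaf with no
    step after it, whence the added [D]. *)
Lemma dtree_dsteps i T w : dtree i T w -> ~~ is_empty T ->
  map flip (dsteps w) ++ [:: D] = canopy (code T).
Proof.
elim: T w => // X IX Y IY w [x [y [z [-> Dx Dy /andP[Hx Hy] _]]]] _ /=.
rewrite /canopy map_cat -!/(canopy _) /= ar_gt0.
have {}IX := IX _ Dx; have {}IY := IY _ Dy.
have E1 : map flip (dsteps (x ++ z :: y)) ++ [:: D] =
    canopy (code X) ++ map flip (dsteps (z :: y)) ++ [:: D].
  case EX: (is_empty X) IX Dx => IX Dx; first by case: (X) EX Dx => //= _ ->.
  rewrite -IX //; case: (x) Dx Hx => [|x0 x1] Dx Hx.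
    by case: (X) EX Dx => //= X1 X2 _ [[|? ?] [? [? []]]].
  rewrite dsteps_cat /cmp map_cat /=.
  have -> : z < last x0 x1 = false.
    by have := allP Hx _ (mem_last x0 x1) => /=; move: (last _ _); clear; lia.
  by rewrite /= -!catA.
rewrite E1; congr (_ ++ _).
case EY: (is_empty Y) IY Dy => IY Dy; first by case: (Y) EY Dy => //= _ ->.
rewrite -IY //; case: (y) Dy Hy => [|y0 y1] Dy Hy.
  by case: (Y) EY Dy => //= Y1 Y2 _ [[|? ?] [? [? []]]].
by rewrite /= /cmp; move: Hy => /= /andP[->].
Qed.

Lemma nth_dsteps i w : i.+1 < size w ->
  nth U (dsteps w) i = if nth 0 w i.+1 < nth 0 w i then D else U.
Proof.
case: w => // x s /= lt; by rewrite (nth_pairmap 0).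
Qed.

Lemma DL_dsteps k p : size p = k.*2.+1 -> size (rot_perm p) = k.*2.+1 ->
  DL k p = (rev (dsteps p), map flip (dsteps (rot_perm p))).
Proof.
move=> sp sr; rewrite /DL; congr pair; apply: (@eq_from_nth _ U).
- by rewrite size_map size_iota size_rev size_dsteps sp.
- move=> i; rewrite size_map size_iota => lt.
  rewrite (nth_map 0) ?size_iota // nth_iota // nth_rev ?size_dsteps sp //=.
  rewrite nth_dsteps ?sp; last by move: lt; clear; lia.
  rewrite /Des inE sp.
  have -> : k.*2.+1 - (1 + i) = (k.*2 - i.+1).+1 by move: lt; clear; lia.
  by have -> : 0 < (k.*2 - i.+1).+1 < k.*2.+1 by move: lt; clear; lia.
- by rewrite !size_map size_iota size_dsteps sr.
- move=> i; rewrite size_map size_iota => lt.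
  rewrite (nth_map 0) ?size_iota // nth_iota // (nth_map U) ?size_dsteps ?sr //.
  rewrite nth_dsteps ?sr // /Des inE sr add1n /= ltnS lt /=.
  by case: ifP.
Qed.

Lemma size_code T : size (code T) = fsize T.
Proof.
by elim: T => //= X IX Y IY; rewrite size_cat /= IX IY addnS addn1.
Qed.

Lemma code_sum T : size (code T) = sumn (code T) + ar T.
Proof.
by elim: T => //= X IX Y IY; rewrite size_cat sumn_cat /= IX IY; lia.
Qed.

Lemma cat_eq_cat (T : Type) (a b c d : seq T) : a ++ b = c ++ d ->
  (exists e, c = a ++ e /\ b = e ++ d) \/ (exists e, a = c ++ e /\ d = e ++ b).
Proof.
move=> E; have [le|lt] := leqP (size a) (size c); first by left; apply: cat_split.
by right; apply: cat_split => //; apply: ltnW.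
Qed.

(** A suffix of a preorder code is the code of a sequence of complete subtrees, and
    [size b - sumn b] is their number. *)
Lemma code_suffix T a b : code T = a ++ b -> b != [::] -> sumn b < size b.
Proof.
elim: T a b => [|X IX Y IY] a b /=; first by case: a b => [|? ?] [|? ?].
move=> E nb; case: (cat_eq_cat E) => [[e [Ea Eb]]|[e [EX Eb]]].
  case: e Ea Eb => [|m e] _ /=; first by move=> <- /=; rewrite code_sum; lia.
  by move=> [_ EY]; apply: IY EY nb.
rewrite Eb sumn_cat size_cat /= code_sum.
have [->|ne] := eqVneq e [::]; first by rewrite /=; lia.
by have := IX _ _ EX ne; lia.
Qed.

Lemma code_inj : injective code.
Proof.
elim=> [|X IX Y IY] [|X' Y'] //=.
- by move/(congr1 size); rewrite size_cat /= addnS.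
- by move/(congr1 size); rewrite size_cat /= addnS.
(* If the last trees began at different places, [ar V' :: s] would be a suffix of a code whose sum
   equals its size, against [code_suffix]. *)
have ne V V' W s : code V' = s ++ ar V :: code V -> forall c, code W = c ++ ar V' :: s -> False.
  move=> EV c EW; have := code_suffix EW isT; have := code_sum V'.
  rewrite EV !size_cat !sumn_cat /= (code_sum V); lia.
move=> E; case: (cat_eq_cat E) => [[e [EX Ey]]|[e [EX Ey]]].
  case: e EX Ey => [|m e] EX /=.
    by rewrite cats0 in EX => -[_ /IY ->]; rewrite (IX _ (esym EX)).
  by case=> Em EY; subst m; case: (ne Y' Y X' e EY _ EX).
case: e EX Ey => [|m e] EX /=.
  by rewrite cats0 in EX => -[_ /esym/IY ->]; rewrite (IX _ EX).
by case=> Em EY; subst m; case: (ne Y Y' X e EY _ EX).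
Qed.

(** The new first node takes the first [m] trees of [T], which form [Y], as its children; only the
    excess of [Y] can then spoil goodness. *)
Lemma good_push T m : good T -> m <= ar T -> exists Y W T',
  [/\ code T = code Y ++ code W, ar Y = m, good Y, good W & code T' = m :: code T] /\
  (is_empty Y || (1 < exc Y) -> good T').
Proof.
elim: T m => [|X IX Z IZ] m.
  by move=> _; case: m => //; exists NoTree, NoTree, (Snoc NoTree NoTree).
move=> gT; rewrite leq_eqVlt => /orP[/eqP Em|lt].
  exists (Snoc X Z), NoTree, (Snoc NoTree (Snoc X Z)); rewrite cats0; split; first by rewrite Em.
  by move=> /= h; move: gT => /= -> /=.
move: gT => /= /and3P[gX gZ hZ].
have [Y [W [T' [[E1 E2 E3 E4 E5] H]]]] := IX m gX lt.
exists Y, (Snoc W Z), (Snoc T' Z); split.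
  by rewrite /= E5 E1 -catA gZ hZ E4; split; rewrite ?cat_cons -?catA.
by move=> /H /= ->; rewrite gZ hZ.
Qed.

Definition zeros (c : seq nat) : nat := count_mem 0 c.
Definition posits (c : seq nat) : nat := count (leq 1) c.

Lemma size_zeros c : size c = zeros c + posits c.
Proof.
by rewrite -(count_predC (pred1 0)); congr (_ + _); apply: eq_count => -[].
Qed.

Lemma size_gam c : size (gam c) = posits c.
Proof.
by rewrite size_map size_filter.
Qed.

Lemma sumn_gam c : sumn (gam c) + posits c = sumn c.
Proof.
by elim: c => //= m c IH; rewrite gam_cons sumn_cat /posits /= -/(posits c); case: m => [|m] /=; lia.
Qed.

Lemma zeros_cat a b : zeros (a ++ b) = zeros a + zeros b.
Proof.
exact: count_cat.
Qed.

Lemma posits_cat a b : posits (a ++ b) = posits a + posits b.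
Proof.
exact: count_cat.
Qed.

Lemma posits_code T : posits (code T) = fint T.
Proof.
elim: T => //= X IX Y IY; rewrite posits_cat IX /posits /= -/(posits _) IY.
by rewrite -ar_gt0; lia.
Qed.

Lemma good_zeros T : good T -> zeros (code T) = exc T + posits (code T).
Proof.
by move=> g; have := exc_fsize g; rewrite -size_code size_zeros posits_code; lia.
Qed.

Lemma good_ar T : good T -> ar T <= exc T.
Proof.
elim: T => //= X IX Y IY /and3P[/IX hX _]; case: is_empty => /=; lia.
Qed.

Lemma good_suffix T a b : good T -> code T = a ++ b -> b != [::] -> posits b < zeros b.
Proof.
elim: T a b => [|X IX Y IY] a b /=; first by case: a b => [|? ?] [|? ?].
move=> /and3P[gX gY hY] E nb.
have tree : posits (ar Y :: code Y) < zeros (ar Y :: code Y).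
  rewrite /posits /zeros /= -/(posits _) -/(zeros _) good_zeros //.
  by case: (Y) hY => //= Y1 Y2; lia.
case: (cat_eq_cat E) => [[e [Ea Eb]]|[e [EX Eb]]].
  case: e Ea Eb => [|m e] _ /=; first by move=> <-.
  by move=> [_ EY]; apply: IY EY nb.
rewrite Eb posits_cat zeros_cat.
have [->|ne] := eqVneq e [::]; first by [].
by have := IX _ _ gX EX ne; lia.
Qed.

(** In a good forest the sum of [m] - 2 over the arities [m] of internal nodes is the excess minus
    the number of trees, which is nonnegative by [good_ar]. *)
Lemma good_suffix_sum T a b : good T -> code T = a ++ b -> (posits b).*2 <= sumn b.
Proof.
elim: T a b => [|X IX Y IY] a b /=; first by case: a b => [|? ?] [|? ?].
move=> /and3P[gX gY hY] E.
have tree : (posits (ar Y :: code Y)).*2 <= sumn (ar Y :: code Y).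
  have := code_sum Y; have := good_zeros gY; rewrite size_zeros /posits /= -/(posits _).
  by case: (Y) hY => //= Y1 Y2; lia.
case: (cat_eq_cat E) => [[e [Ea Eb]]|[e [EX Eb]]].
  case: e Ea Eb => [|m e] _ /=; first by move=> <-.
  by move=> [_ EY]; apply: IY EY.
rewrite Eb posits_cat sumn_cat.
by have := IX _ _ gX EX; lia.
Qed.

Lemma good_subtree T a m b : good T -> code T = a ++ m :: b ->
  exists Y b', [/\ m = ar Y, b = code Y ++ b', good Y & is_empty Y || (1 < exc Y)].
Proof.
elim: T a m b => [|X IX Y IY] a m b /=; first by case: a.
move=> /and3P[gX gY hY] E; case: (cat_eq_cat E) => [[e [Ea Eb]]|[e [EX Eb]]].
  case: e Ea Eb => [|m' e] _ /=.
    by case=> <- <-; exists Y, [::]; rewrite cats0.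
  by move=> [_ EY]; apply: IY EY.
case: e EX Eb => [|m' e] EX /= [].
  by move=> -> ->; exists Y, [::]; rewrite cats0.
move=> Em Eb; subst m'; have [Y' [b' [-> E2 gY' hY']]] := IX _ _ _ gX EX.
by exists Y', (b' ++ ar Y :: code Y); rewrite Eb E2 -catA.
Qed.

(** * Tamari intervals *)

Lemma sumn_take_drop a (g : seq nat) : sumn (take a g) + sumn (drop a g) = sumn g.
Proof.
by rewrite -sumn_cat cat_take_drop.
Qed.

Lemma gammas_nseq_D n w : gammas (nseq n D ++ w) = gammas w.
Proof.
by elim: n.
Qed.

Lemma gammas_blocks g : gammas (blocks g) = g.
Proof.
elim: g => //= x g IH; rewrite gammas_nseq_D -/(blocks g) IH; congr cons.
rewrite index_cat mem_nseq andbF size_nseq.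
by case: (g) => [|y g'] /=; rewrite addn0.
Qed.

Lemma count_blocks_cat g : count_mem U (blocks g) = size g /\ count_mem D (blocks g) = sumn g.
Proof.
exact: count_blocks.
Qed.

(** The Dyck condition on exponents, tested only at the ends of the blocks. *)
Definition ballot (k : nat) (g : seq nat) : Prop :=
  [/\ size g = k, sumn g = k & forall a, sumn (take a g) <= a].

Lemma Dyck_ballot k w : Dyck k w -> ballot k (gammas w) /\ w = blocks (gammas w).
Proof.
move=> W; have [HU HD Hpre] := W.
have Ew : w = blocks (gammas w) by rewrite {1}(gammasK w) (Dyck_index W).
split=> //; split.
- by rewrite size_gammas.
- by rewrite -HD [in RHS]Ew; case: (count_blocks_cat (gammas w)).
- move=> a; have := Hpre (size (blocks (take a (gammas w)))).
  have -> : take (size (blocks (take a (gammas w)))) w = blocks (take a (gammas w)).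
    by rewrite {2}Ew -{2}(cat_take_drop a (gammas w)) blocks_cat take_size_cat.
  have [-> ->] := count_blocks_cat (take a (gammas w)).
  by move=> h; apply: leq_trans h _; rewrite size_take_min geq_minl.
Qed.

(** [h] is a starting height; after a block with exponent [x] the induction continues from height
    [h.+1 - x]. *)
Lemma blocks_prefix g h i : (forall a, sumn (take a g) <= a + h) ->
  count_mem D (take i (blocks g)) <= count_mem U (take i (blocks g)) + h.
Proof.
elim: g h i => [|x g IH] h i H //=; case: i => [|i] //=.
have Hx : x <= h.+1 by have := H 1; rewrite /= take0 /= addn0 add1n.
rewrite take_cat size_nseq; case: ltnP => le.
  rewrite take_nseq ?(ltnW le) // !count_nseq /=; lia.
rewrite !count_cat !count_nseq /= -/(blocks g).
have := IH (h.+1 - x) (i - x); move: (count_mem D _) (count_mem U _) => cd cu.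
move=> h'; suff : cd <= cu + (h.+1 - x) by lia.
apply: h' => a; have := H a.+1; rewrite /=; lia.
Qed.

Lemma ballot_Dyck k g : ballot k g -> Dyck k (blocks g).
Proof.
case=> sg ug pg; have [HU HD] := count_blocks_cat g.
split; [by rewrite HU | by rewrite HD | move=> i].
by have := @blocks_prefix g 0 i; rewrite addn0; apply=> a; rewrite addn0.
Qed.

Lemma big_sumn j t (g : seq nat) : 0 < j ->
  \sum_(j <= i < (j + t).+1) nth 0 g i.-1 = sumn (take t.+1 (drop j.-1 g)).
Proof.
have nthS (s : seq nat) n : sumn (take n.+1 s) = sumn (take n s) + nth 0 s n.
  have [lt|ge] := ltnP n (size s); first by rewrite (take_nth 0) // sumn_rcons.
  by rewrite nth_default // addn0 !take_oversize // ltnW.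
move=> j0; elim: t => [|t IH].
  by rewrite addn0 big_nat1 nthS take0 nth_drop addn0.
rewrite addnS big_nat_recr /=; last by rewrite -addnS leq_addr.
by rewrite IH [RHS]nthS nth_drop; congr (_ + nth 0 g _); move: j0; clear; lia.
Qed.

(* The comparison of [lon] on exponents, with indices from 0: if up-step j is not matched in blocks
   j, ..., j + t of the first path, neither is it in those of the second one. *)
Definition lon_le (g g' : seq nat) : Prop := forall j t, j + t < size g ->
  (forall s, s <= t -> sumn (take s.+1 (drop j g)) <= s) ->
  forall s, s <= t -> sumn (take s.+1 (drop j g')) <= s.

Lemma tamari_leP k w w' : Dyck k w -> Dyck k w' ->
  tamari_le k w w' <-> lon_le (gammas w) (gammas w').
Proof.
move=> W W'; have [[sg _ _] _] := Dyck_ballot W.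
split=> H.
  move=> j t; rewrite sg => ltk B s st.
  have Hj : 1 <= j.+1 <= k by move: ltk; clear; lia.
  have [_ [L2 _]] := lonP W Hj; have [_ [_ L3]] := lonP W' Hj.
  rewrite big_sumn //= in L2.
  have tl : t < lon w j.+1.
    by rewrite ltnNge; apply/negP => /B; rewrite leqNgt L2.
  have := L3 s; rewrite big_sumn //=; apply.
  by apply: leq_ltn_trans st _; apply: leq_trans tl _; apply: H.
move=> j Hj; have [_ [_ L3]] := lonP W Hj; have [K1 [K2 _]] := lonP W' Hj.
have j0 : 0 < j by case/andP: Hj.
rewrite big_sumn // in K2; rewrite leqNgt; apply/negP => lt.
have tk : j.-1 + lon w' j < k by move: K1 j0; clear; lia.
have B s : s <= lon w' j -> sumn (take s.+1 (drop j.-1 (gammas w))) <= s.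
  by move=> st; rewrite -big_sumn //; apply: L3; apply: leq_ltn_trans lt.
have := H j.-1 (lon w' j); rewrite sg => /(_ tk B (lon w' j) (leqnn _)).
by rewrite leqNgt K2.
Qed.

(* When s is a segment of exponents, [unmatched s] counts the up-steps whose matching down-step lies
   beyond s, and [excess s] the down-steps matching an up-step before s. *)
Fixpoint excess (s : seq nat) : nat := if s is x :: s' then (x + excess s').-1 else 0.
Fixpoint unmatched (s : seq nat) : nat :=
  if s is x :: s' then unmatched s' + (x + excess s' == 0) else 0.

(** Once matched pairs are cancelled, [unmatched s] up-steps and [excess s] down-steps remain. *)
Lemma unmatched_sum s : unmatched s + sumn s = size s + excess s.
Proof.
by elim: s => //= x s; case: eqP => /=; lia.
Qed.

Lemma excess_le s h : (excess s <= h) <-> (forall a, sumn (take a s) <= a + h).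
Proof.
elim: s h => [|x s IH] h /=; first by split.
split=> [H [|a] //=|H].
  have [x0|x0] := posnP (x + excess s).
    have /IH/(_ a) : excess s <= 0 by lia.
    by lia.
  have /IH/(_ a) : excess s <= h.+1 - x by lia.
  by lia.
have Hx := H 1; rewrite /= take0 /= in Hx.
have /IH : forall a, sumn (take a s) <= a + (h.+1 - x).
  by move=> a; have := H a.+1; rewrite /=; lia.
by lia.
Qed.

(** The up-step [j] is one of those counted by [unmatched s]. *)
Definition open_at (s : seq nat) (j : nat) : Prop :=
  forall t, j + t < size s -> sumn (take t.+1 (drop j s)) <= t.

Lemma open_at0 x s : (x + excess s == 0) <-> open_at (x :: s) 0.
Proof.
split=> [|H].
  rewrite addn_eq0 => /andP[/eqP -> /eqP e] t _; rewrite drop0 /=.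
  have /excess_le/(_ t) : excess s <= 0 by rewrite e.
  by rewrite addn0.
have x0 : x = 0 by have := H 0 isT; rewrite drop0 /= take0 /=; lia.
rewrite x0 add0n -leqn0; apply/excess_le => a; rewrite addn0.
have [le|lt] := leqP a (size s); first by have := H a le; rewrite drop0 /= x0.
have := H (size s) (ltnSn _); rewrite drop0 /= x0 take_size take_oversize; lia.
Qed.

Lemma unmatched_le s s' : size s = size s' ->
  (forall j, j < size s -> open_at s j -> open_at s' j) -> unmatched s <= unmatched s'.
Proof.
elim: s s' => [|x s IH] [|x' s'] //= [ss] H; apply: leq_add.
  apply: IH => // j lt O t; rewrite -ss => ltt.
  by have := H j.+1 lt O t; rewrite /= -ss; apply.
case E : (x + excess s == 0) => //; rewrite lt0b.
by apply/open_at0; apply: H => //; apply/open_at0.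
Qed.

(** The larger path in the Tamari order lies weakly above the smaller one. A prefix of a Dyck path
    has no excess, so [a - sumn (take a g)] counts its unmatched up-steps, and by [lon_le] these
    stay unmatched in the other path. *)
Lemma lon_le_sum k g g' a : ballot k g -> ballot k g' -> lon_le g g' -> a <= k ->
  sumn (take a g') <= sumn (take a g).
Proof.
move=> [sg _ pg] [sg' _ pg'] L le.
have exc0 s : (forall a, sumn (take a s) <= a) -> excess (take a s) = 0.
  move=> H; apply/eqP; rewrite -leqn0; apply/excess_le => b; rewrite addn0.
  rewrite -take_min; apply: leq_trans (H _) _; exact: geq_minl.
have sz s : size s = k -> size (take a s) = a by move=> E; rewrite size_takel ?E.
have := unmatched_sum (take a g); have := unmatched_sum (take a g').
rewrite !exc0 // !sz // => E1 E2.
suff : unmatched (take a g) <= unmatched (take a g') by lia.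
apply: unmatched_le; first by rewrite !sz.
rewrite sz // => j ltj O t; rewrite sz // => ltt.
have tk s u : j + u < a -> take u.+1 (drop j (take a s)) = take u.+1 (drop j s).
  by move=> lu; rewrite -{1}(subnKC (ltnW ltj)) addnC -take_drop take_takel //; lia.
rewrite tk //; apply: (L j t) => //; first by rewrite sg; lia.
move=> s st; rewrite -tk; last by lia.
by apply: O; rewrite sz //; lia.
Qed.

(** The preorder code rebuilt from two paths, without its final leaf: an exponent of the first path
    fixes the arity of an internal node, the one of the second path the number of leaves between it
    and the next internal node. *)
Definition inter (g g' : seq nat) : seq nat := flatten [seq x.1.+1 :: nseq x.2 0 | x <- zip g g'].

Lemma gam_nseq0 n c : gam (nseq n 0 ++ c) = gam c.
Proof.
by elim: n => //= n IH; rewrite gam_cons IH.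
Qed.

Lemma canopy_cat a b : canopy (a ++ b) = canopy a ++ canopy b.
Proof.
exact: map_cat.
Qed.

Lemma canopy_nseq0 n : canopy (nseq n 0) = nseq n D.
Proof.
exact: map_nseq.
Qed.

Lemma gam_inter g g' : size g = size g' -> gam (inter g g') = g.
Proof.
by elim: g g' => [|x g IH] [|x' g'] //= [E]; rewrite gam_cons gam_nseq0 IH.
Qed.

Lemma canopy_inter g g' : size g = size g' -> canopy (inter g g') = blocks g'.
Proof.
elim: g g' => [|x g IH] [|x' g'] //= [E].
by rewrite -[_ :: _]/(canopy [:: x.+1] ++ _) /= -/(canopy _) canopy_cat canopy_nseq0 IH.
Qed.

Lemma gam_canopy_inj c c' : gam c = gam c' -> canopy c = canopy c' -> c = c'.
Proof.
elim: c c' => [|m c IH] [|m' c'] //=; rewrite !gam_cons.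
case: m m' => [|m] [|m'] //= E [] => [Ec|Ec]; first by rewrite (IH c').
by case: E => -> Eg; rewrite (IH c').
Qed.

Lemma inter_cat g g' a : size g = size g' ->
  inter g g' = inter (take a g) (take a g') ++ inter (drop a g) (drop a g').
Proof.
move=> E; rewrite /inter -flatten_cat -map_cat -zip_cat ?size_take ?E //.
by rewrite !cat_take_drop.
Qed.

Lemma zeros_nseq0 n : zeros (nseq n 0) = n.
Proof.
by rewrite /zeros count_nseq mul1n.
Qed.

Lemma posits_inter g g' : size g = size g' -> posits (inter g g') = size g.
Proof.
by move=> E; rewrite -size_gam gam_inter.
Qed.

Lemma zeros_inter g g' : size g = size g' -> zeros (inter g g') = sumn g'.
Proof.
elim: g g' => [|x g IH] [|x' g'] //= [E].
by rewrite /zeros /= count_cat -!/(zeros _) zeros_nseq0 IH.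
Qed.

Lemma sumn_inter g g' : size g = size g' -> sumn (inter g g') = sumn g + size g.
Proof.
elim: g g' => [|x g IH] [|x' g'] //= [E].
by rewrite sumn_cat sumn_nseq IH //; lia.
Qed.

Lemma size_inter g g' : size g = size g' -> size (inter g g') = size g + sumn g'.
Proof.
by move=> E; rewrite size_zeros posits_inter // zeros_inter // addnC.
Qed.

(** The prefix [u] stops before its next internal node, so all its leaves belong to the blocks it
    has already entered. *)
Lemma prefix_zeros g g' u v : size g = size g' -> inter g g' = u ++ v ->
  zeros u <= sumn (take (posits u) g').
Proof.
move=> E Euv; have [le|lt] := leqP (size g) (posits u).
  rewrite take_oversize -?E // -(zeros_inter E) Euv zeros_cat; exact: leq_addr.
have St : size (take (posits u) g) = size (take (posits u) g') by rewrite !size_take E.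
have Sd : size (drop (posits u) g) = size (drop (posits u) g') by rewrite !size_drop E.
have := inter_cat (posits u) E; rewrite Euv => /esym/cat_eq_cat [[e [Eu Ev]]|[e [Ei Ev]]].
  case: e Eu Ev => [|m e] Eu Ev.
    by rewrite {1}Eu cats0 zeros_inter.
  have /(congr1 posits) := Eu; rewrite posits_cat posits_inter // size_takel ?(ltnW lt) //.
  have m0 : 0 < m.
    move: Ev; rewrite (drop_nth 0 lt) (drop_nth 0 (_ : posits u < size g')) -?E //=.
    by case=> <-.
  rewrite /posits /= m0; lia.
by rewrite -(zeros_inter St) Ei zeros_cat leq_addr.
Qed.

(** Both prefix conditions are suffix conditions on [code T], as the total sums are [k]. For
    [lon_le], the block where the second path first matches up-step [j] lies within the subtree at
    node [j], and by its end the first path has matched it too. *)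
Lemma good_ballot k T c g g' : good T -> ar T = 1 -> exc T = 1 -> code T = c ++ [:: 0] ->
  c = inter g g' -> size g = k -> size g' = k -> [/\ ballot k g, ballot k g' & lon_le g g'].
Proof.
move=> gT aT eT Ec Eci sg sg'; have E : size g = size g' by rewrite sg sg'.
have Eg : sumn g = k.
  have := code_sum T; rewrite Ec size_cat sumn_cat Eci size_inter // sumn_inter // aT /=.
  have := good_zeros gT; rewrite Ec eT zeros_cat posits_cat Eci zeros_inter // posits_inter //.
  by rewrite /zeros /posits /=; lia.
have Eg' : sumn g' = k.
  have := good_zeros gT; rewrite Ec eT zeros_cat posits_cat Eci zeros_inter // posits_inter //.
  by rewrite /zeros /posits /=; lia.
have Ecut a : code T = inter (take a g) (take a g') ++ (inter (drop a g) (drop a g') ++ [:: 0]).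
  by rewrite Ec Eci catA -inter_cat.
have Sd a : size (drop a g) = size (drop a g') by rewrite !size_drop E.
have St a : size (take a g) = size (take a g') by rewrite !size_take E.
split; first split=> //.
- move=> a; have := good_suffix_sum gT (Ecut a).
  rewrite posits_cat sumn_cat posits_inter // sumn_inter // size_drop /posits /= !addn0.
  have := sumn_take_drop a g; lia.
- split=> // a; have := good_suffix gT (Ecut a).
  rewrite -size_eq0 size_cat addn1 => /(_ isT).
  rewrite posits_cat zeros_cat posits_inter // zeros_inter // size_drop /posits /zeros /= !addn0.
  have := sumn_take_drop a g'; lia.
move=> j t ltjt B s0 s0t; rewrite leqNgt; apply/negP => bad.
pose P s := s < sumn (take s.+1 (drop j g')).
have exP : exists s, P s by exists s0.
case: (ex_minnP exP) => s Ps mins.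
have {s0 s0t bad}st : s <= t by apply: leq_trans s0t; apply: mins.
have /(_ s st) := B; rewrite leqNgt => /negP; apply.
set G := drop j g in B *; set G' := drop j g' in P Ps mins exP *.
have EG : size G = size G' by apply: Sd.
have sG : s < size G by rewrite size_drop; move: ltjt st; clear; lia.
have [x [G1 EG1]] : exists x G1, G = x :: G1 by case: (G) sG => // x G1; exists x, G1.
have [x' [G1' EG1']] : exists x' G1', G' = x' :: G1'.
  by move: EG; rewrite EG1; case: (G') => // y G1'; exists y, G1'.
have := Ecut j; rewrite -/G -/G' => EcT.
have EcT' := EcT; rewrite EG1 EG1' /= in EcT'.
have [Y [b' [Em Eb gY hY]]] := good_subtree gT EcT'.
set sub := x.+1 :: code Y.
have Esub : inter G G' ++ [:: 0] = sub ++ b' by rewrite EG1 EG1' /sub /= Eb.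
have gsub : gam sub = take (posits sub) G.
  have := congr1 gam Esub; rewrite !gam_cat gam_inter // cats0 => ->.
  by rewrite -size_gam take_size_cat.
have zsub : posits sub < zeros sub.
  rewrite /posits /zeros /= -/(posits _) -/(zeros _) (good_zeros gY).
  by move: hY Em; case: (Y) => //= Y1 Y2 + _; lia.
have sum_sub : size sub = (sumn sub).+1.
  by rewrite /sub /= code_sum Em; lia.
have psub : 0 < posits sub by [].
(* The subtree has more leaves than internal nodes, so the second path matches its up-step by the
   end of the subtree at the latest. *)
have ltsq : s < posits sub.
  rewrite ltnNge; apply/negP => le.
  have : P (posits sub).-1.
    (* If the subtree reaches the end of the code, it contains the final leaf, which no exponent of
       [g'] counts; the strict inequality allows for this. *)
    rewrite /P prednK //; case/lastP: b' Eb Esub => [|b' z] Eb Esub.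
      have Ep : posits sub = size G.
        by have := congr1 posits Esub; rewrite cats0 posits_cat posits_inter // addn0.
      have Ez : zeros sub = sumn G' + 1.
        by have := congr1 zeros Esub; rewrite cats0 zeros_cat zeros_inter.
      by rewrite take_oversize ?Ep ?EG //; move: Ez zsub psub; rewrite Ep EG; clear; lia.
    have [Ei _] : inter G G' = sub ++ b' /\ 0 = z.
      by move: Esub; rewrite -cats1 catA !cats1 => /rcons_inj[].
    have := prefix_zeros EG Ei; move: zsub psub; lia.
  by move/mins; move: le psub; clear; lia.
(* If all internal nodes of the subtree are used, its exponents in [g] add up to its number of
   leaves minus 1, which is at least [s.+1]. *)
rewrite -/G; have [E1|lt1] := eqVneq s.+1 (posits sub).
  rewrite E1 -gsub; have := sumn_gam sub; have := size_zeros sub; lia.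
(* Otherwise a nonempty rest [v] of the subtree remains. By [code_suffix] its sum is less than its
   size, so the sum of [u] is at least its size: the partial sum of [G] is at least that of [G']. *)
have [u [v [Ev Eu]]] : exists u v, sub = u ++ v /\ u = inter (take s.+1 G) (take s.+1 G').
  have Ecut2 := inter_cat s.+1 EG; move: Esub; rewrite Ecut2 -catA => /cat_eq_cat[[e [E1 _]]|[e [E1 _]]].
    by exists (inter (take s.+1 G) (take s.+1 G')), e.
  have := congr1 posits E1; rewrite posits_cat posits_inter ?size_take ?EG //.
  by move: ltsq lt1 (geq_minl s.+1 (size G')); rewrite /minn; case: ltnP => *; lia.
have sG1 : s.+1 <= size G by [].
have pu : posits u = s.+1 by rewrite Eu posits_inter ?size_take_min ?EG // (minn_idPl _) // -EG.
have nv : v != [::].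
  by apply/eqP => Ev0; move: lt1; rewrite Ev Ev0 cats0 pu eqxx.
have sv : sumn v < size v.
  case: u Ev {Eu pu} => [|u0 u] /= Ev.
    by rewrite -Ev sum_sub.
  by case: Ev => _ Ev; apply: code_suffix Ev nv.
have : size u <= sumn u.
  by move: sum_sub; rewrite Ev size_cat sumn_cat; move: sv; clear; lia.
rewrite Eu size_inter ?sumn_inter ?size_take ?EG //.
by move: Ps; rewrite /P; clear; lia.
Qed.

Lemma push_leaves T n : good T -> exists T', good T' /\ code T' = nseq n 0 ++ code T.
Proof.
move=> gT; elim: n => [|n [T' [g' E']]]; first by exists T.
have [Y [W [T2 [[E1 E2 E3 E4 E5] H]]]] := good_push g' (leq0n _).
exists T2; split; first by apply: H; case: (Y) E2.
by rewrite E5 E'.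
Qed.

Lemma drop_gam c n : exists a b, c = a ++ b /\ drop n (gam c) = gam b.
Proof.
elim: c n => [|m c IH] n; first by exists [::], [::].
case: n => [|n]; first by exists [::], (m :: c); rewrite drop0.
have [a [b [Eab Ed]]] := IH (n.+1 - (0 < m)); exists (m :: a), b; rewrite Eab; split=> //.
by rewrite gam_cons -Eab -Ed; case: (m) => //= m'; rewrite ?subn0 ?subSS ?subn0.
Qed.

(** The tree is built from right to left: for each [j], the leaves of block [j] are pushed first and
    then the internal node. [lon_le_sum] provides enough trees to be its children, and [lon_le]
    makes the new subtree good. *)
Lemma ballot_good k g g' : ballot k g -> ballot k g' -> lon_le g g' ->
  exists T, [/\ good T, ar T = 1, exc T = 1 & code T = inter g g' ++ [:: 0]].
Proof.
move=> Bg Bg' L; have [sg ug pg] := Bg; have [sg' ug' pg'] := Bg'.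
have E : size g = size g' by rewrite sg sg'.
have Sd a : size (drop a g) = size (drop a g') by rewrite !size_drop E.
have St a : size (take a g) = size (take a g') by rewrite !size_take E.
have key n j : j + n = k -> exists T, good T /\ code T = inter (drop j g) (drop j g') ++ [:: 0].
  elim: n j => [|n IH] j Ej.
    by exists (Snoc NoTree NoTree); rewrite !drop_oversize ?sg ?sg' -?Ej ?addn0.
  have [T0 [g0 E0]] := IH j.+1 (etrans (addSnnS _ _) Ej).
  have [T1 [g1 E1]] := push_leaves (nth 0 g' j) g0.
  have ltj : j < k by move: Ej; clear; lia.
  have Ed : drop j g = nth 0 g j :: drop j.+1 g by rewrite -drop_nth ?sg.
  have Ed' : drop j g' = nth 0 g' j :: drop j.+1 g' by rewrite -drop_nth ?sg'.
  have Eb : inter (drop j g) (drop j g') ++ [:: 0] = (nth 0 g j).+1 :: code T1.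
    by rewrite Ed Ed' E1 E0 /= catA.
  (* [ar T1] exceeds the wanted arity by the difference of the sums of the first [j] exponents of
     [g] and [g']. *)
  have le : (nth 0 g j).+1 <= ar T1.
    have := code_sum T1; have := lon_le_sum Bg Bg' L (ltnW ltj).
    have := sumn_take_drop j g; have := sumn_take_drop j g'.
    have := congr1 size Eb; have := congr1 sumn Eb.
    rewrite size_cat sumn_cat size_inter // sumn_inter // size_drop /=; lia.
  have [Y [W [T2 [[EY aY gY gW E2] H]]]] := good_push g1 le.
  exists T2; split; last by rewrite E2 -Eb.
  apply: H; apply/orP; right; have := good_ar gY; rewrite aY.
  (* An arity of at least 2 already gives excess at least 2; what remains to exclude is a single
     child of excess 1. *)
  case Em : (nth 0 g j) aY => [|m] aY; last by lia.
  rewrite leq_eqVlt => /orP[/eqP eY|//]; exfalso.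
  set sub := 1 :: code Y.
  have Esub : inter (drop j g) (drop j g') ++ [:: 0] = sub ++ code W.
    by rewrite Eb EY Em.
  have gsub : gam sub = take (posits sub) (drop j g).
    have := congr1 gam Esub; rewrite !gam_cat gam_inter // cats0 => ->.
    by rewrite -size_gam take_size_cat.
  have zsub : zeros sub = posits sub.
    by rewrite /posits /zeros /= -/(posits _) -/(zeros _) (good_zeros gY) -eY.
  have ssub : sumn (gam sub) + 1 = posits sub.
    have s1 : size sub = (size (code Y)).+1 by [].
    have s2 : sumn sub = (sumn (code Y)).+1 by [].
    move: (sumn_gam sub) (code_sum Y) (size_zeros sub) s1 s2 zsub; rewrite aY; clear; lia.
  have lesub : posits sub <= size (drop j g).
    rewrite -(posits_inter (Sd j)); have := congr1 posits Esub.
    by rewrite !posits_cat {2}/posits /=; lia.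
  (* When the subtree uses up the whole code, the exponents of [g] from [j] on sum to one less than
     their number, so the first path would go below the axis before block [j]. *)
  case/lastP EW: (code W) Esub => [|W' z] Esub.
    have Ep : posits sub = size (drop j g).
      by have := congr1 posits Esub; rewrite cats0 posits_cat posits_inter // addn0.
    have := pg j; have := sumn_take_drop j g; move: gsub ssub; rewrite Ep take_size size_drop.
    by move=> ->; rewrite sg ug; move: ltj; clear; lia.
  have [Ei _] : inter (drop j g) (drop j g') = sub ++ W' /\ 0 = z.
    by move: Esub; rewrite -cats1 catA !cats1 => /rcons_inj[].
  (* The leaves of the subtree match up-step [j] in the second path; the contradiction is that the
     first path leaves it unmatched up to the same block. *)
  have := prefix_zeros (Sd j) Ei; rewrite zsub leqNgt => /negP; apply.
  have p0 : 0 < posits sub by [].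
  rewrite -(prednK p0) ltnS; apply: (L j (posits sub).-1) => //.
    by move: lesub p0; rewrite size_drop sg; move: ltj; clear; lia.
  move=> s les; have Ets : take s.+1 (drop j g) = take s.+1 (gam sub).
    by rewrite gsub take_takel // -(prednK p0).
  rewrite Ets gam_cons /= add0n.
  (* The exponents coming from [Y] have total equal to their number, and every suffix of them sums
     to at least its size; so every prefix sums to at most its size. *)
  have Hs := good_suffix_sum gY.
  have := sumn_take_drop s (gam (code Y)).
  have Esum : sumn (gam (code Y)) + 1 = posits sub by move: ssub; rewrite gam_cons.
  have Esz : size (gam (code Y)) + 1 = posits sub by rewrite size_gam /posits /= addnC.
  have : size (drop s (gam (code Y))) <= sumn (drop s (gam (code Y))).
    have [a [b [Eab ->]]] := drop_gam (code Y) s.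
    by rewrite size_gam; have := Hs a b Eab; have := sumn_gam b; lia.
  rewrite size_drop; lia.
have [T [gT ET]] := key k 0 erefl; rewrite !drop0 in ET.
have aT : ar T = 1.
  have := code_sum T; rewrite ET size_cat sumn_cat size_inter // sumn_inter // sg ug ug' /=; lia.
exists T; split=> //; have := good_zeros gT.
by rewrite ET zeros_cat posits_cat zeros_inter // posits_inter // /zeros /posits /= sg ug'; lia.
Qed.

(** * The bijection *)

Lemma Sn_perm_word n p : Sn n p -> perm_word p.
Proof.
by move=> P; rewrite /perm_word (Sn_uniq P) (Sn_mem P).
Qed.

Lemma US132_forest n p : US n.+1 [:: 1; 3; 2] p ->
  exists T, [/\ Sn n.+1 p, shape132 T p, good T & exc T = 1].
Proof.
case=> P Up /avoids132P N; have [T S] := shape132_exists (Sn_uniq P) N.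
have p0 : p != [::] by rewrite -size_eq0 (Sn_size P).
by have [g e] := uniquely_sorted_shape Up p0 S; exists T.
Qed.

Lemma forest_US132 n T p : Sn n p -> shape132 T p -> good T -> exc T = 1 ->
  US n [:: 1; 3; 2] p.
Proof.
move=> P S g e; split=> //; last by apply/avoids132P; apply: shape132_no132 S.
by apply: tight_uniquely_sorted (shape132_tight S g e); apply: shape132_sortable S g e; apply: Sn_perm_word P.
Qed.

Lemma forest_US312 n T p : Sn n p -> shape312 T p -> good T -> exc T = 1 ->
  US n [:: 3; 1; 2] p.
Proof.
move=> P S g e; have N := shape312_no312 S; split=> //; last exact/avoids312P.
have t := shape312_tight S g e.
apply: (tight_uniquely_sorted _ t); apply: (no312_sortable (Sn_perm_word P) N _ t).
  by rewrite (shape312_empty S); case: (T) e.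
by move=> a b; apply: shape312_suffix S g e.
Qed.

Lemma DL_swl k T p : Sn k.*2.+1 p -> shape132 T p -> good T -> exc T = 1 ->
  (DL k (swl p)).1 = blocks (gam (code T)) /\ (DL k (swl p)).2 ++ [:: D] = canopy (code T).
Proof.
move=> P S g e; have [Ps Ds] := swl_dtree P S; have S3 := swl_shape312 P S.
have [Y ET] := good_single g e; have nT : ~~ is_empty T by rewrite ET.
rewrite (DL_dsteps (Sn_size Ps) (Sn_size (rot_perm_Sn Ps))) /=.
by rewrite (shape312_dsteps S3 nT) (dtree_dsteps Ds nT) ET.
Qed.

(** The last letter of the code is the leaf behind the extra [D]; the rest is recovered from its
    exponents and its canopy by [gam_canopy_inj]. *)
Lemma code_inter k T L L' : good T -> exc T = 1 -> fsize T = k.*2.+1 ->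
    L = blocks (gam (code T)) -> L' ++ [:: D] = canopy (code T) ->
  exists g g', [/\ L = blocks g, L' = blocks g', ballot k g, ballot k g' & lon_le g g'].
Proof.
move=> gT eT sT EL EL'; have [Y ET] := good_single gT eT.
have aT : ar T = 1 by rewrite ET.
case/lastP Ec: (code T) => [|c m]; first by move: sT; rewrite -size_code Ec.
rewrite -cats1 in Ec; move: EL'; rewrite Ec canopy_cat /= !cats1 => /rcons_inj[EL' Em].
have m0 : m = 0 by case: (m) Em.
subst m; have Eg : gam (code T) = gam c by rewrite Ec gam_cat cats0.
have sg : size (gam c) = k.
  by have := exc_fsize gT; rewrite -posits_code -size_gam Eg; move: sT; rewrite eT; clear; lia.
have sg' : size (gammas (canopy c)) = k.
  rewrite size_gammas /canopy count_map -sg size_gam; apply: eq_count => -[] //.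
(* The canopy starts with the root, which is internal unless the tree is a single leaf, and then [c]
   is empty. *)
have EU : index U (canopy c) = 0.
  move: Ec; rewrite ET /=; case: (c) => //= m c' [<- Ec'].
  rewrite ar_gt0; case: (Y) Ec' => //= Ec'.
  by move: (congr1 size Ec'); rewrite size_cat addn1.
have Ecan : canopy c = blocks (gammas (canopy c)) by rewrite {1}(gammasK (canopy c)) EU.
have Eci : c = inter (gam c) (gammas (canopy c)).
  by apply: gam_canopy_inj; rewrite ?gam_inter ?canopy_inter ?sg ?sg'.
have [B B' le] := good_ballot gT aT eT Ec Eci sg sg'.
by exists (gam c), (gammas (canopy c)); split; rewrite // ?EL ?Eg // EL'.
Qed.

Theorem theorem6p4 (k : nat) :
  set_fun (US k.*2.+1 [:: 1; 3; 2]) (US k.*2.+1 [:: 3; 1; 2]) swl /\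
  set_bij (US k.*2.+1 [:: 1; 3; 2]) (Int (Dyck k) (tamari_le k))
    (fun p => DL k (swl p)).
Proof.
split.
  move=> p /US132_forest[T [P S g e]]; have [Ps _] := swl_dtree P S.
  exact: forest_US312 Ps (swl_shape312 P S) g e.
split.
- move=> p /US132_forest[T [P S g e]]; have [E1 E2] := DL_swl P S g e.
  have sT : fsize T = k.*2.+1 by rewrite -(shape132_size S) (Sn_size P).
  have [a [b [Ea Eb Ba Bb le]]] := code_inter g e sT E1 E2.
  split; rewrite ?Ea ?Eb; try exact: ballot_Dyck.
  by apply/tamari_leP; rewrite ?gammas_blocks //; apply: ballot_Dyck.
- move=> p q /set_mem/US132_forest[T [P S g e]] /set_mem/US132_forest[T' [P' S' g' e']] E.
  have [E1 E2] := DL_swl P S g e; have [E1' E2'] := DL_swl P' S' g' e'.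
  have ET : T = T'.
    apply: code_inj; apply: gam_canopy_inj; last by rewrite -E2 -E2' E.
    by rewrite -[LHS]gammas_blocks -[RHS]gammas_blocks -E1 -E1' E.
  by subst T'; apply: shape132_unique S S' P P'.
- move=> [L L'] [/= DyL DyL' le]; have [Ba Ea] := Dyck_ballot DyL; have [Bb Eb] := Dyck_ballot DyL'.
  have [sa ua _] := Ba; have [sb ub _] := Bb.
  have sE : size (gammas L) = size (gammas L') by rewrite sa sb.
  have [T [g _ e Ec]] := ballot_good Ba Bb (proj1 (tamari_leP DyL DyL') le).
  have [p [S P]] := shape132_construct T 1.
  have sT : fsize T = k.*2.+1.
    by rewrite -size_code Ec size_cat size_inter // sa ub addnn addn1.
  rewrite sT in P; exists p; first exact: forest_US132 P S g e.
  have [E1 E2] := DL_swl P S g e.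
  move: E1 E2; rewrite Ec gam_cat gam_inter // cats0 canopy_cat canopy_inter // !cats1 -Ea -Eb.
  by case: (DL k (swl p)) => u v /= -> /rcons_inj[->].
Qed.
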